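(* Let $m$ be a positive integer. Then for $a,b\in\mathbb{C}$, $$T_{e^{az}}T_{\overline{e^{bz}}}=T_{e^{az}\overline{e^{bz}}}\ \text{ on } F^{2,m}(\mathbb{C})\quad\text{if and only if}\quad ab=0.$$ In particular, the following characterization (valid on the Fock space $F^2$, i.e. for $m=0$) does not hold on $F^{2,m}(\mathbb{C})$: ''for all $f,g\in\epsilon(\mathbb{C})$, the following are equivalent: (a) $T_fT_{\overline g}=T_{f\overline g}$; (b) $\widetilde{f\overline g}=f\overline g$; (c) either (1) $f$ or $g$ is constant, or (2) there are finite collections $\{a_j\}_{j=1}^N$ and $\{b_l\}_{l=1}^M$ of distinct complex numbers such that $f\in\mathrm{Span}\{K_{a_1},\dots,K_{a_N}\}$ and $g\in\mathrm{Span}\{K_{b_1},\dots,K_{b_M}\}$, with $a_j\overline{b_l}\in 2\pi \mathrm{i}\,\mathbb{Z}$ for each $j$ and $l$'', where the Toeplitz operators and Berezin transform are those of $F^{2,m}(\mathbb{C})$ and $K_a(z)=e^{\overline{a}z}$ is the reproducing kernel of $F^2$.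
   Context: Let $dA$ be area measure on $\mathbb{C}$ and $m$ a non-negative integer. The Fock space $F^2$ is the space of entire functions $f$ with $\frac1\pi\int_{\mathbb{C}}|f(z)|^2e^{-|z|^2}dA(z)<\infty$. The Fock-Sobolev space $F^{2,m}(\mathbb{C})$ consists of all entire $f$ with $f^{(m)}\in F^2$; equivalently, all entire $f$ with $z^m f(z)\in F^2$. Let $L^2_m$ be the Hilbert space of measurable functions $f$ on $\mathbb{C}$ with $|z|^m f(z)\in L^2(\mathbb{C},e^{-|z|^2}dA)$, with inner product $$\langle f,g\rangle_m=\frac{1}{\pi m!}\int_{\mathbb{C}} f(z)\overline{g(z)}|z|^{2m}e^{-|z|^2}dA(z).$$ $F^{2,m}(\mathbb{C})$ is regarded as a closed subspace of $L^2_m$ with this inner product; its reproducing kernel is $K_m(z,w)=\sum_{k=0}^\infty \frac{m!}{(k+m)!}(z\overline{w})^k$. The set $D$ of all finite linear combinations of the kernel functions $K_m(\cdot,w)$, $w\in\mathbb{C}$, is dense in $F^{2,m}(\mathbb{C})$. For a measurable symbol $\varphi$ on $\mathbb{C}$ with $\int_{\mathbb{C}}|\varphi(w)||K_m(z,w)||w|^{2m}e^{-|w|^2}dA(w)<\infty$, the Toeplitz operator is the (possibly unbounded) densely defined operator on $F^{2,m}(\mathbb{C})$ given by $$T_\varphi f(z)=\frac{1}{\pi m!}\int_{\mathbb{C}} \varphi(w)f(w)K_m(z,w)|w|^{2m}e^{-|w|^2}dA(w).$$ The Berezin transform of $\varphi$ is $\widetilde{\varphi}(z)=\langle \varphi k_z,k_z\rangle_m$,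 where $k_z(w)=K_m(w,z)/\sqrt{K_m(z,z)}$. $\epsilon(\mathbb{C})$ is the set of entire functions $g$ on $\mathbb{C}$ such that $|g(z)|e^{-c|z|}$ is essentially bounded on $\mathbb{C}$ for some $c>0$. In symbols such as $T_{e^{az}}$, the subscript denotes the function $z\mapsto e^{az}$. *)

(* Defs.v *)
From HB Require Import structures.
From mathcomp Require Import all_boot all_order all_algebra.
From mathcomp Require Import complex.
From mathcomp Require Import all_classical all_reals all_analysis.
From mathcomp Require Import ess_sup_inf.

Set Implicit Arguments.
Unset Strict Implicit.
Unset Printing Implicit Defensive.

Import Order.TTheory GRing.Theory Num.Theory.
Import numFieldNormedType.Exports.

Local Open Scope classical_set_scope.
Local Open Scope ring_scope.
Local Open Scope complex_scope.

Section FockSobolev.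
Context {R : realType}.
Local Notation C := R[i].
Local Notation Re := complex.Re.
Local Notation Im := complex.Im.
Implicit Types (m : nat) (f g phi psi chi : C -> C) (a z w : C).

(* The library's norm on R[i] is R[i]-valued; this is the same modulus,
   valued in R. *)
Definition cabs z : R := Normc.normc z.

Definition cexp z : C :=
  (expR (Re z))%:C * (cos (Im z) +i* sin (Im z)).

(* Area measure lives on R * R, identified with the plane by (x, y) |-> x + iy. *)
Definition area :
  {measure set (measurableTypeR R * measurableTypeR R) -> \bar R} :=
  (@lebesgue_measure R \x @lebesgue_measure R)%E.

Definition of_plane (p : R * R) : C := p.1 +i* p.2.

Definition cmeasurable f :=
  measurable_fun [set: R * R] (fun p => Re (f (of_plane p))) /\
  measurable_fun [set: R * R] (fun p => Im (f (of_plane p))).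

Definition cintegrable f :=
  area.-integrable [set: R * R] (fun p => (Re (f (of_plane p)))%:E) /\
  area.-integrable [set: R * R] (fun p => (Im (f (of_plane p)))%:E).

(* Total; meaningful only when [cintegrable f]. *)
Definition cintegral f : C :=
  (\int[area]_(p in [set: R * R]) Re (f (of_plane p)))%R +i*
  (\int[area]_(p in [set: R * R]) Im (f (of_plane p)))%R.

(* [C^o] is C as a normed module over itself, so this is complex
   differentiability at every point. *)
Definition entire f := forall z, derivable (f : C^o -> C^o) z 1.

Definition nth_derivative m f : C -> C := derive1n m (f : C^o -> C^o).

Definition Fock f :=
  entire f /\
  ((pi^-1)%:E * \int[area]_(p in [set: R * R])
     (cabs (f (of_plane p)) ^+ 2 * expR (- cabs (of_plane p) ^+ 2))%:E
   < +oo)%E.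

Definition FockSobolev m f := entire f /\ Fock (nth_derivative m f).

Definition fs_weight m w : R := cabs w ^+ (2 * m) * expR (- cabs w ^+ 2).

Definition fs_inner m f g : C :=
  ((pi * m`!%:R)^-1)%:C *
  cintegral (fun w => f w * conjc (g w) * (fs_weight m w)%:C).

Definition fs_kernel m z w : C :=
  lim (series (fun k => (m`!%:R / (k + m)`!%:R) * (z * conjc w) ^+ k : C^o) @ \oo).

(* [ker w] is read as a function of its second argument. *)
Definition in_span (ker : C -> C -> C) (s : seq C) f :=
  exists c : C -> C, forall z, f z = \sum_(w <- s) c w * ker w z.

Definition kernel_span m f :=
  exists s : seq C, in_span (fun w z => fs_kernel m z w) s f.

Definition toeplitz_symbol m phi :=
  cmeasurable phi /\
  forall z, (\int[area]_(p in [set: R * R])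
     (cabs (phi (of_plane p)) * cabs (fs_kernel m z (of_plane p)) *
      fs_weight m (of_plane p))%:E < +oo)%E.

Definition toeplitz m phi f z : C :=
  ((pi * m`!%:R)^-1)%:C *
  cintegral (fun w => phi w * f w * fs_kernel m z w * (fs_weight m w)%:C).

Definition toeplitz_domain m phi f :=
  [/\ toeplitz_symbol m phi, FockSobolev m f,
      forall z, cintegrable
        (fun w => phi w * f w * fs_kernel m z w * (fs_weight m w)%:C)
    & FockSobolev m (toeplitz m phi f)].

(* T_phi T_psi = T_chi as densely defined operators: on the dense span of the
   kernel functions both sides are defined and agree.  [toeplitz] is total, so
   definedness is part of the condition; it holds automatically for symbols
   f, conj g and f * conj g with f and g satisfying [exp_type] below. *)
Definition toeplitz_prod_eq m phi psi chi :=
  forall f, kernel_span m f ->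
    [/\ toeplitz_domain m psi f, toeplitz_domain m phi (toeplitz m psi f),
        toeplitz_domain m chi f
      & forall z, toeplitz m phi (toeplitz m psi f) z = toeplitz m chi f z].

Definition normalized_kernel m z w : C :=
  fs_kernel m w z / sqrtC (fs_kernel m z z).

Definition berezin m phi z : C :=
  fs_inner m (fun w => phi w * normalized_kernel m z w) (normalized_kernel m z).

Definition exp_type g :=
  entire g /\
  exists2 c : R, 0 < c &
    (ess_sup area (fun p : R * R =>
       (cabs (g (of_plane p)) * expR (- c * cabs (of_plane p)))%:E) < +oo)%E.

Definition Fock_kernel a z : C := cexp (conjc a * z).

Definition is_constant f := exists c : C, forall z, f z = c.

Definition span_condition f g :=
  exists s t : seq C,
    [/\ uniq s, uniq t, in_span Fock_kernel s f, in_span Fock_kernel t g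
      & forall a b, a \in s -> b \in t ->
          exists k : int, a * conjc b = (2 * pi * k%:~R)%:C * 'i].

Definition semicommuting m f g :=
  toeplitz_prod_eq m f (fun z => conjc (g z)) (fun z => f z * conjc (g z)).

Definition berezin_fixed m f g :=
  forall z, berezin m (fun w => f w * conjc (g w)) z = f z * conjc (g z).

End FockSobolev.

Definition semicommuting_characterization (R : realType) (m : nat) :=
  forall f g : R[i] -> R[i], exp_type f -> exp_type g ->
    (semicommuting m f g <-> berezin_fixed m f g) /\
    (berezin_fixed m f g <->
       (is_constant f \/ is_constant g) \/ span_condition f g).

(* Main.v *)
(* Against the weight |z|^(2m) exp(-|z|^2) the monomials are orthogonal with
   <z^n, z^n>_m = (n+m)!/m!, so T_phi f = phi f for analytic phi, and
   T_(conj g) K_w = conj (g w) K_w.  If ab = 0, the product symbol is one of its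
   two factors, and the two sides agree on the kernel functions.  Conversely,
   comparing the two sides on the constant K_0 = 1 and writing x = a conj(b), the
   coefficient of z^n gives, for a <> 0,
     sum_k x^k/k! C(n+m+k, m) = C(n+m, m)    for every n.
   Taking differences in n (Pascal's rule) lowers the degree m of the binomials:
   when m >= 1 one reaches e^x = 1 and x e^x = 0, so that x = 0.  For m = 0 only
   e^x = 1 is left, which is why b = 2 pi i / conj(a), allowed in the
   characterization on F^2, is a counterexample as soon as m >= 1. *)
Require Import Defs.
From mathcomp Require Import all_boot all_order all_algebra.
From mathcomp Require Import complex all_classical all_reals all_analysis.
From mathcomp Require Import measurable_realfun ess_sup_inf.
From mathcomp Require Import ring lra.

Set Implicit Arguments.
Unset Strict Implicit.
Unset Printing Implicit Defensive.

Import Order.TTheory GRing.Theory Num.Theory.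
Import numFieldNormedType.Exports.

Local Open Scope classical_set_scope.
Local Open Scope ring_scope.
Local Open Scope complex_scope.

(** * Complex modulus and convergence *)

Section Modulus.
Context {R : realType}.
Local Notation C := R[i].
Local Notation Re := complex.Re.
Local Notation Im := complex.Im.
Implicit Types (z w : C).

(** The identity in [x] arises as follows. Once the kernel is expanded, the coefficient of z^n in
    the image of 1 under the Toeplitz operator of the product symbol is m!/(n+m)! times the inner
    product of that symbol with z^n. Expanding only conj(e^{bw}) and using orthogonality turns it
    into (m! a^n/(n+m)!) sum_k x^k/k! C(n+m+k, m), to be compared with a^n/n!; dividing by a^n is
    where a <> 0 enters. The work lies in the exchanges of sum and integral. All functions involved
    are bounded by M exp(A|z|), and A t - t^2 <= A^2/2 - t^2/2 turns such a bound into one Gaussian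
    majorant, so dominated convergence applies throughout. As [area] is a product measure, the
    moments are found by integrating by parts in each real variable, not by polar coordinates.
    Equality of operators includes membership in F^{2,m}, so growth bounds are also needed for
    derivatives up to order m. *)

Lemma normr_cabs z : `|z| = (cabs z)%:C.
Proof. by case: z. Qed.

Lemma cabs_ge0 z : 0 <= cabs z.
Proof. by case: z => x y; rewrite /cabs /= sqrtr_ge0. Qed.

Lemma cabsM z w : cabs (z * w) = cabs z * cabs w.
Proof. exact: Normc.normcM. Qed.

Lemma cabsD z w : cabs (z + w) <= cabs z + cabs w.
Proof. exact: le_normcD. Qed.

Lemma cabsN z : cabs (- z) = cabs z.
Proof. exact: normcN. Qed.

Lemma cabs0 : cabs (0 : C) = 0.
Proof. exact: Normc.normc0. Qed.

Lemma cabs1 : cabs (1 : C) = 1.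
Proof. exact: Normc.normc1. Qed.

Lemma cabs0_eq0 z : cabs z = 0 -> z = 0.
Proof. exact: Normc.eq0_normc. Qed.

Lemma cabsX z n : cabs (z ^+ n) = cabs z ^+ n.
Proof. by elim: n => [|n IHn]; rewrite ?expr0 ?cabs1// !exprS cabsM IHn. Qed.

Lemma sqr_cabs z : cabs z ^+ 2 = Re z ^+ 2 + Im z ^+ 2.
Proof. by case: z => x y /=; rewrite /cabs /= sqr_sqrtr// addr_ge0// sqr_ge0. Qed.

Lemma cabs_real (x : R) : cabs x%:C = `|x|.
Proof. by rewrite /cabs /= expr0n /= addr0 sqrtr_sqr. Qed.

Lemma cabs_conjc z : cabs (conjc z) = cabs z.
Proof. by case: z => x y; rewrite /cabs /= sqrrN. Qed.

Lemma cabs_nat n : cabs (n%:R : C) = n%:R.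
Proof. by rewrite -(rmorph_nat (real_complex R)) cabs_real ger0_norm. Qed.

Lemma cabsV z : cabs z^-1 = (cabs z)^-1.
Proof. exact: Normc.normcV. Qed.

Lemma normr_Re_le z : `|Re z| <= cabs z.
Proof.
by rewrite -[leRHS]ger0_norm ?cabs_ge0// -ler_sqr ?nnegrE// !real_normK ?num_real//
  sqr_cabs lerDl sqr_ge0.
Qed.

Lemma normr_Im_le z : `|Im z| <= cabs z.
Proof.
by rewrite -[leRHS]ger0_norm ?cabs_ge0// -ler_sqr ?nnegrE// !real_normK ?num_real//
  sqr_cabs lerDr sqr_ge0.
Qed.

Lemma cabs_le_ReIm z : cabs z <= `|Re z| + `|Im z|.
Proof.
rewrite -[leRHS]ger0_norm; last by rewrite addr_ge0.
rewrite -[leLHS]ger0_norm ?cabs_ge0// -ler_sqr ?nnegrE// !real_normK ?num_real//.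
rewrite sqr_cabs sqrrD !real_normK ?num_real//.
by rewrite addrAC lerDl mulrn_wge0// mulr_ge0.
Qed.

Lemma cabs_sum I (r : seq I) (P : pred I) (F : I -> C) :
  cabs (\sum_(i <- r | P i) F i) <= \sum_(i <- r | P i) cabs (F i).
Proof.
elim/big_ind2 : _ => [|x1 y1 x2 y2 h1 h2|i _]; rewrite ?cabs0//.
by rewrite (le_trans (cabsD _ _))// lerD.
Qed.

Lemma cReD z w : Re (z + w) = Re z + Re w. Proof. by case: z w => ? ? []. Qed.
Lemma cImD z w : Im (z + w) = Im z + Im w. Proof. by case: z w => ? ? []. Qed.
Lemma cReN z : Re (- z) = - Re z. Proof. by case: z. Qed.
Lemma cImN z : Im (- z) = - Im z. Proof. by case: z. Qed.
Lemma cReB z w : Re (z - w) = Re z - Re w. Proof. by rewrite cReD cReN. Qed.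
Lemma cImB z w : Im (z - w) = Im z - Im w. Proof. by rewrite cImD cImN. Qed.
Lemma cReM z w : Re (z * w) = Re z * Re w - Im z * Im w.
Proof. by case: z w => ? ? []. Qed.
Lemma cImM z w : Im (z * w) = Re z * Im w + Im z * Re w.
Proof. by case: z w => ? ? []. Qed.

Lemma complex_eqP z w : Re z = Re w -> Im z = Im w -> z = w.
Proof. by case: z w => a b [c d] /= -> ->. Qed.

(** The norm of [C^o] is C-valued, and there [0 < e] forces [e] to be real. Convergence therefore
    reduces to that of a real sequence, where squeezing is available. *)
Lemma ccvgP (u : nat -> C) (l : C) :
  ((u : nat -> C^o) @ \oo --> (l : C^o)) <->
  (cabs (u n - l) @[n --> \oo] --> (0 : R)).
Proof.
split => [/cvgrPdist_lt h|/cvgrPdist_lt h]; apply/cvgrPdist_lt => e e0.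
  have /h : (0 : C) < e%:C by rewrite ltcR.
  apply: filterS => n; rewrite normr_cabs ltcR sub0r normrN ger0_norm ?cabs_ge0//.
  by rewrite -cabsN opprB.
move: e0; rewrite ltcE /= => /andP[/eqP ime re0].
have := h _ re0; apply: filterS => n.
rewrite sub0r normrN ger0_norm ?cabs_ge0// normr_cabs => ltn.
by rewrite ltcE /= ime eqxx /= -cabsN opprB.
Qed.


Lemma rcvg_dist (u v : nat -> R) (l : R) :
  (forall n, `|u n - l| <= v n) -> v @ \oo --> (0 : R) -> u @ \oo --> l.
Proof.
move=> uv v0; apply/cvgrPdist_le => e e0.
move/cvgrPdist_le : v0 => /(_ e e0); apply: filterS => n.
rewrite sub0r normrN distrC => ve; rewrite (le_trans (uv n))// (le_trans _ ve)//.
exact: ler_norm.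
Qed.

Lemma ccvg_squeeze (u : nat -> C) (l : C) (v : nat -> R) :
  (forall n, cabs (u n - l) <= v n) -> v @ \oo --> (0 : R) ->
  (u : nat -> C^o) @ \oo --> (l : C^o).
Proof.
move=> uv v0; apply/ccvgP; apply: (squeeze_cvgr _ (cvg_cst 0) v0).
by near=> n; rewrite cabs_ge0 uv.
Unshelve. all: by end_near. Qed.

Lemma ccvg_Re (u : nat -> C) (l : C) :
  (u : nat -> C^o) @ \oo --> (l : C^o) -> Re (u n) @[n --> \oo] --> Re l.
Proof.
by move=> /ccvgP; apply: rcvg_dist => n; rewrite -cReB normr_Re_le.
Qed.

Lemma ccvg_Im (u : nat -> C) (l : C) :
  (u : nat -> C^o) @ \oo --> (l : C^o) -> Im (u n) @[n --> \oo] --> Im l.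
Proof.
by move=> /ccvgP; apply: rcvg_dist => n; rewrite -cImB normr_Im_le.
Qed.

Lemma ccvg_ReIm (u : nat -> C) (a b : R) :
  Re (u n) @[n --> \oo] --> a -> Im (u n) @[n --> \oo] --> b ->
  (u : nat -> C^o) @ \oo --> (a +i* b : C^o).
Proof.
move=> ha hb; apply: (@ccvg_squeeze _ _ (fun n => `|Re (u n) - a| + `|Im (u n) - b|)).
  move=> n; rewrite (le_trans (cabs_le_ReIm _))// cReB cImB//=.
have aux (v : nat -> R) l : v @ \oo --> l -> `|v n - l| @[n --> \oo] --> (0 : R).
  move=> vl; have : (v n - l) @[n --> \oo] --> l - l by apply: cvgB => //; exact: cvg_cst.
  by rewrite subrr => /cvg_norm; rewrite normr0.
by rewrite -[X in _ --> X]addr0; apply: cvgD; exact: aux.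
Qed.

Lemma ccvg_unique (u : nat -> C) (l l' : C) :
  (u : nat -> C^o) @ \oo --> (l : C^o) -> (u : nat -> C^o) @ \oo --> (l' : C^o) -> l = l'.
Proof. by apply: cvg_unique; exact: norm_hausdorff. Qed.

Lemma ccvg_cabs (u : nat -> C) (l : C) :
  (u : nat -> C^o) @ \oo --> (l : C^o) -> cabs (u n) @[n --> \oo] --> cabs l.
Proof.
move=> /ccvgP; apply: rcvg_dist => n.
have h1 := cabsD (u n - l) l; have h2 := cabsD (l - u n) (u n).
rewrite !subrK -(cabsN (l - u n)) opprB in h1 h2.
by rewrite ler_norml; lra.
Qed.

Lemma ccvg_conjc (u : nat -> C) (l : C) :
  (u : nat -> C^o) @ \oo --> (l : C^o) ->
  ((fun n => conjc (u n)) : nat -> C^o) @ \oo --> (conjc l : C^o).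
Proof.
move=> /ccvgP h; apply: (ccvg_squeeze _ h) => n.
by rewrite -rmorphB cabs_conjc.
Qed.

Lemma ccvg_le (u : nat -> C) (l : C) (M : R) :
  (u : nat -> C^o) @ \oo --> (l : C^o) -> (forall n, cabs (u n) <= M) -> cabs l <= M.
Proof.
move=> /ccvg_cabs ul uM; have <- := cvg_lim (@Rhausdorff R) ul.
by apply: limr_le; [exact: cvgP ul|near=> n].
Unshelve. all: by end_near. Qed.

Lemma ccvgM (u v : nat -> C) (l l' : C) :
  (u : nat -> C^o) @ \oo --> (l : C^o) -> (v : nat -> C^o) @ \oo --> (l' : C^o) ->
  ((fun n => u n * v n) : nat -> C^o) @ \oo --> (l * l' : C^o).
Proof.
move=> ul vl; have /ccvgP ul0 := ul; have /ccvgP vl0 := vl.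
apply: (@ccvg_squeeze _ _ (fun n => cabs (u n) * cabs (v n - l') + cabs l' * cabs (u n - l))).
  move=> n; rewrite (_ : _ - _ = u n * (v n - l') + l' * (u n - l)); last by ring.
  by rewrite (le_trans (cabsD _ _))// !cabsM.
rewrite (_ : 0 = cabs l * 0 + cabs l' * 0 :> R); last by rewrite !mulr0 addr0.
apply: cvgD; first by apply: cvgM => //; exact: ccvg_cabs.
by apply: cvgM => //; exact: cvg_cst.
Qed.

Lemma ccvg_cst (a : C) : ((fun _ => a) : nat -> C^o) @ \oo --> (a : C^o).
Proof.
apply: (@ccvg_squeeze _ _ (fun _ => 0)); last exact: cvg_cst.
by move=> n; rewrite subrr cabs0.
Qed.

Lemma ccvgD (u v : nat -> C) (l l' : C) :
  (u : nat -> C^o) @ \oo --> (l : C^o) -> (v : nat -> C^o) @ \oo --> (l' : C^o) ->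
  ((fun n => u n + v n) : nat -> C^o) @ \oo --> (l + l' : C^o).
Proof.
move=> /ccvgP ul /ccvgP vl.
apply: (@ccvg_squeeze _ _ (fun n => cabs (u n - l) + cabs (v n - l'))).
  by move=> n; rewrite opprD addrACA cabsD.
by rewrite -[X in _ --> X](addr0 (0 : R)); exact: cvgD.
Qed.

Lemma ccvgMl (a : C) (v : nat -> C) (l' : C) :
  (v : nat -> C^o) @ \oo --> (l' : C^o) ->
  ((fun n => a * v n) : nat -> C^o) @ \oo --> (a * l' : C^o).
Proof. by move=> vl; exact: (@ccvgM (fun _ => a) v a l' (@ccvg_cst a) vl). Qed.

Arguments ccvgMl a {v l'} _.
Arguments ccvg_cst a : clear implicits.

Lemma ccvgB (u v : nat -> C) (l l' : C) :
  (u : nat -> C^o) @ \oo --> (l : C^o) -> (v : nat -> C^o) @ \oo --> (l' : C^o) ->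
  ((fun n => u n - v n) : nat -> C^o) @ \oo --> (l - l' : C^o).
Proof.
move=> ul /(ccvgMl (-1)) vl; rewrite -mulN1r.
by under eq_fun do rewrite -mulN1r; exact: ccvgD.
Qed.

End Modulus.

Arguments ccvgMl {R} a {v l'} _.

(** * Power series with factorially bounded coefficients *)

Section PowerSeries.
Context {R : realType}.
Local Notation C := R[i].
Local Notation Re := complex.Re.
Local Notation Im := complex.Im.
Implicit Types (z w : C) (c d : nat -> C) (M A : R).

Lemma exp_partial_le (x : R) n : 0 <= x -> \sum_(k < n) x ^+ k / k`!%:R <= expR x.
Proof.
move=> x0; have := @nondecreasing_cvgn_le R (series (exp_coeff x)) _ _ n.
rewrite /series/= big_mkord; apply; last exact: is_cvg_series_exp_coeff.
by apply/nondecreasing_seqP => k; rewrite /= big_nat_recr//= lerDl exp_coeff_ge0.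
Qed.

(** The coefficient form of the growth bound M exp(A|z|). It holds for the exponential, for the
    kernel and for the image of 1 under the product symbol; differentiation changes only [M]. *)
Definition fact_bounded M A c :=
  [/\ 0 <= M, 0 <= A & forall k, cabs (c k) <= M * (A ^+ k / k`!%:R)].

Definition psum c n z : C := \sum_(k < n) c k * z ^+ k.

Definition pseriesC c z : C :=
  lim (series (fun k => c k * z ^+ k : C^o) @ \oo).

Lemma psum_series c z : (fun n => psum c n z) = series (fun k => c k * z ^+ k).
Proof. by apply/funext => n; rewrite /series/= big_mkord. Qed.

Lemma fact_bounded_term M A c k z : fact_bounded M A c ->
  cabs (c k * z ^+ k) <= M * ((A * cabs z) ^+ k / k`!%:R).
Proof.
move=> [M0 A0 cb]; rewrite cabsM cabsX exprMn.
rewrite (le_trans (ler_wpM2r _ (cb k))) ?exprn_ge0 ?cabs_ge0//.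
by rewrite le_eqVlt; apply/orP; left; apply/eqP; ring.
Qed.

Lemma psum_le M A c n z : fact_bounded M A c ->
  cabs (psum c n z) <= M * expR (A * cabs z).
Proof.
move=> cb; have [M0 A0 _] := cb; rewrite (le_trans (cabs_sum _ _ _))//.
rewrite (@le_trans _ _ (\sum_(k < n) M * ((A * cabs z) ^+ k / k`!%:R)))//.
  by apply: ler_sum => k _; exact: fact_bounded_term.
by rewrite -mulr_sumr ler_wpM2l// exp_partial_le// mulr_ge0 ?cabs_ge0.
Qed.

Lemma psum_cvg M A c z : fact_bounded M A c ->
  (fun n => psum c n z : C^o) @ \oo --> (pseriesC c z : C^o).
Proof.
move=> cb; have [M0 A0 _] := cb.
(* Absolute convergence by comparison with [M] times an exponential series; [f] will be the real and
   the imaginary part. *)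
have H (f : C -> R) : (forall u v, f (u + v) = f u + f v) -> f 0 = 0 ->
    (forall u, `|f u| <= cabs u) -> cvgn (fun n => f (psum c n z)).
  move=> fD f0 fle.
  have -> : (fun n => f (psum c n z)) = series (fun k => f (c k * z ^+ k)).
    by apply/funext => n; rewrite /series/= big_mkord (big_morph f fD f0).
  apply: normed_cvg.
  apply: (@series_le_cvg _ _ (fun k => M * exp_coeff (A * cabs z) k)).
  - by move=> k /=.
  - by move=> k; rewrite mulr_ge0// exp_coeff_ge0// mulr_ge0 ?cabs_ge0.
  - by move=> k /=; rewrite (le_trans (fle _))//; exact: fact_bounded_term.
  - exact/is_cvg_seriesZ/is_cvg_series_exp_coeff.
have hr := H (@complex.Re R) (@cReD _) erefl (@normr_Re_le _).
have hi := H (@complex.Im R) (@cImD _) erefl (@normr_Im_le _).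
have := @ccvg_ReIm _ (fun n => psum c n z) _ _ hr hi.
rewrite /pseriesC -psum_series => h.
by have -> := cvg_lim (@norm_hausdorff _ _) h.
Qed.

Arguments psum_cvg {M A c} z _.

Lemma pseriesC_le M A c z : fact_bounded M A c ->
  cabs (pseriesC c z) <= M * expR (A * cabs z).
Proof. by move=> cb; apply: (ccvg_le (psum_cvg z cb)) => n; exact: psum_le. Qed.

Lemma pseriesC_eq c z l :
  (fun n => psum c n z : C^o) @ \oo --> (l : C^o) -> pseriesC c z = l.
Proof.
move=> h; rewrite /pseriesC -psum_series.
by apply: cvg_lim h; exact: norm_hausdorff.
Qed.

Lemma pseriesC_at0 c : pseriesC c 0 = c 0%N.
Proof.
apply: pseriesC_eq; apply: (@ccvg_squeeze _ _ _ (fun n => cabs (c 0%N) * (n == 0%N)%:R)).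
  move=> [|n]; rewrite /psum.
    by rewrite big_ord0 sub0r cabsN mulr1.
  rewrite big_ord_recl expr0 mulr1 big1 ?addr0 ?subrr ?cabs0 ?mulr_ge0 ?cabs_ge0//.
  by move=> i _; rewrite /= expr0n mulr0.
apply: cvg_near_cst; exists 1%N => // -[|n]//= _.
by rewrite mulr0.
Qed.

(** Second-order Taylor bound for a monomial. The constant, twice the sharp one, is chosen to cancel
    against (k+2)! when the bounds are summed. *)
Lemma expr_remainder_le z w (r : R) k : cabs z <= r -> cabs w <= r ->
  cabs (w ^+ k.+2 - z ^+ k.+2 - k.+2%:R * (w - z) * z ^+ k.+1) <=
  cabs (w - z) ^+ 2 * (k.+2 * k.+1)%:R * r ^+ k.
Proof.
move=> zr wr; have r0 : 0 <= r by rewrite (le_trans _ zr) ?cabs_ge0.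
elim: k => [|k IH].
  rewrite expr0 mulr1 (_ : _ - _ - _ = (w - z) ^+ 2); last by ring.
  by rewrite cabsX ler_peMr ?exprn_ge0 ?cabs_ge0 ?ler1n.
rewrite (_ : w ^+ k.+3 - _ - _ =
    w * (w ^+ k.+2 - z ^+ k.+2 - k.+2%:R * (w - z) * z ^+ k.+1) +
    k.+2%:R * (w - z) ^+ 2 * z ^+ k.+1); last first.
  rewrite -[k.+3%:R]natr1 [z ^+ k.+3]exprS [z ^+ k.+2]exprS [w ^+ k.+3]exprS.
  have key (x y W Z N : C) : x * W - y * (y * Z) - (N + 1) * (x - y) * (y * Z) =
      x * (W - y * Z - N * (x - y) * Z) + N * (x - y) ^+ 2 * Z by ring.
  exact: key.
rewrite (le_trans (cabsD _ _))// !cabsM !cabsX cabs_nat.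
have h1 : cabs w * cabs (w ^+ k.+2 - z ^+ k.+2 - k.+2%:R * (w - z) * z ^+ k.+1) <=
    r * (cabs (w - z) ^+ 2 * (k.+2 * k.+1)%:R * r ^+ k).
  by rewrite ler_pM ?cabs_ge0.
have h2 : k.+2%:R * cabs (w - z) ^+ 2 * cabs z ^+ k.+1 <=
   k.+2%:R * cabs (w - z) ^+ 2 * r ^+ k.+1.
  by rewrite ler_wpM2l ?mulr_ge0 ?exprn_ge0 ?cabs_ge0// lerXn2r ?nnegrE ?cabs_ge0.
rewrite (le_trans (lerD h1 h2))// [r ^+ k.+1]exprS !natrM.
rewrite (_ : _ + _ = cabs (w - z) ^+ 2 * (k.+2%:R * k.+2%:R) * (r * r ^+ k)); last first.
  rewrite -[k.+2%:R]natr1; move: (r ^+ k) (k.+1%:R) => W N; ring.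
rewrite ler_wpM2r ?mulr_ge0 ?exprn_ge0// ler_wpM2l ?exprn_ge0 ?cabs_ge0//.
by rewrite ler_wpM2r// ler_nat.
Qed.

Definition pderiv c : nat -> C := fun k => k.+1%:R * c k.+1.

Lemma fact_bounded_pderiv M A c : fact_bounded M A c ->
  fact_bounded (M * A) A (pderiv c).
Proof.
move=> [M0 A0 cb]; split => //; first by rewrite mulr_ge0.
move=> k; rewrite /pderiv cabsM cabs_nat.
rewrite (le_trans (ler_wpM2l _ (cb _)))// factS natrM exprS.
have f0 : (k`!%:R : R) != 0 by rewrite pnatr_eq0 -lt0n fact_gt0.
have n0 : (k.+1%:R : R) != 0 by rewrite pnatr_eq0.
rewrite le_eqVlt; apply/orP; left; apply/eqP.
by move: (k`!%:R) f0 (k.+1%:R) n0 => f f0 n n0; field; rewrite f0.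
Qed.

Lemma psum_remainder_le M A c z w (r : R) n : fact_bounded M A c ->
  cabs z <= r -> cabs w <= r ->
  cabs (psum c n.+2 w - psum c n.+2 z - (w - z) * psum (pderiv c) n.+1 z) <=
  cabs (w - z) ^+ 2 * (M * A ^+ 2 * expR (A * r)).
Proof.
move=> [M0 A0 cb] zr wr; have r0 : 0 <= r by rewrite (le_trans _ zr) ?cabs_ge0.
(* Degrees 0 and 1 leave no remainder, hence the shift by 2; the derivative of a sum of n + 2 terms
   has n + 1 terms. *)
rewrite (_ : _ - _ - _ = \sum_(k < n) c k.+2 *
   (w ^+ k.+2 - z ^+ k.+2 - k.+2%:R * (w - z) * z ^+ k.+1)); last first.
  have E (u : C) : psum c n.+2 u = c 0%N + c 1%N * u + \sum_(k < n) c k.+2 * u ^+ k.+2.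
    by rewrite /psum 2!big_ord_recl expr0 mulr1 expr1 addrA.
  rewrite !E /psum big_ord_recl /pderiv expr0 /= mulr1 mul1r mulrDr mulr_sumr.
  rewrite [RHS](eq_bigr (fun k : 'I_n => c k.+2 * w ^+ k.+2 - c k.+2 * z ^+ k.+2 -
     (w - z) * (k.+2%:R * c k.+2 * z ^+ k.+1))); last by move=> k _; ring.
  by rewrite !sumrB; ring.
rewrite (le_trans (cabs_sum _ _ _))//.
apply: (@le_trans _ _ (\sum_(k < n) cabs (w - z) ^+ 2 * (M * A ^+ 2 * ((A * r) ^+ k / k`!%:R)))).
  apply: ler_sum => k _; rewrite cabsM.
  rewrite (le_trans (ler_pM (cabs_ge0 _) (cabs_ge0 _) (cb _) (expr_remainder_le k zr wr)))//.
  have f0 : (k`!%:R : R) != 0 by rewrite pnatr_eq0 -lt0n fact_gt0.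
  have n0 : (k.+1%:R : R) != 0 by rewrite pnatr_eq0.
  have p0 : (k.+2%:R : R) != 0 by rewrite pnatr_eq0.
  rewrite le_eqVlt; apply/orP; left; apply/eqP.
  rewrite !factS !natrM exprMn ![A ^+ k.+2]exprS [A ^+ k.+1]exprS.
  move: (k`!%:R) f0 (k.+1%:R) n0 (k.+2%:R) p0 => f f0 q q0 p p0.
  by field; rewrite f0 q0.
rewrite -2!mulr_sumr ler_wpM2l ?exprn_ge0 ?cabs_ge0// ler_wpM2l ?mulr_ge0 ?exprn_ge0//.
by rewrite exp_partial_le// mulr_ge0.
Qed.

Lemma pseriesC_remainder_le M A c z w (r : R) : fact_bounded M A c ->
  cabs z <= r -> cabs w <= r ->
  cabs (pseriesC c w - pseriesC c z - (w - z) * pseriesC (pderiv c) z) <=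
  cabs (w - z) ^+ 2 * (M * A ^+ 2 * expR (A * r)).
Proof.
move=> cb zr wr.
have cvS u d B : fact_bounded M B d \/ fact_bounded (M * A) A d -> forall k,
    (fun n => psum d (n + k) u : C^o) @ \oo --> (pseriesC d u : C^o).
  by move=> [|] db k; rewrite (@cvg_shiftn k _ (fun n => psum d n u : C^o)); exact: psum_cvg db.
have h : (fun n => (psum c (n + 2) w - psum c (n + 2) z - (w - z) * psum (pderiv c) (n + 1) z : C^o)) @ \oo
   --> (pseriesC c w - pseriesC c z - (w - z) * pseriesC (pderiv c) z : C^o).
  apply: ccvgB; first by apply: ccvgB; apply: cvS; left; exact: cb.
  apply: ccvgMl.
  by apply: (cvS z _ A); right; exact: fact_bounded_pderiv.
apply: (ccvg_le h) => n; rewrite addn2 addn1.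
exact: psum_remainder_le.
Qed.

Lemma is_derive_quadratic (f : C -> C) z (d : C) (K : R) :
  (forall h, cabs h <= 1 -> cabs (f (z + h) - f z - h * d) <= cabs h ^+ 2 * K) ->
  is_derive (z : C^o) (1 : C^o) (f : C^o -> C^o) d.
Proof.
move=> fd.
have K1 : 0 < `|K| + 1 by rewrite ltr_wpDl.
have cvgd : (fun h : C^o => h^-1 *: (((f : C^o -> C^o) \o shift (z : C^o)) (h *: (1 : C^o)) - f z)) @ (0 : C^o)^' --> (d : C^o).
  apply/cvgrPdist_lt => e e0.
  have [re0 ime] : 0 < Re e /\ Im e = 0 by move: e0; rewrite ltcE /= => /andP[/eqP -> ->].
  (* The bound 1 keeps [h] in the range of the hypothesis; the other makes |h| K smaller than
     [Re e], the [+ 1] avoiding a division by 0. *)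
  pose dl : R := Num.min 1 (Re e / (`|K| + 1)).
  have dl0 : 0 < dl by rewrite lt_min ltr01 divr_gt0.
  near=> h.
  have hn0 : h != 0 by near: h; exact: nbhs_dnbhs_neq.
  have hdl : cabs h < dl.
    have : `|h| < dl%:C.
      by near: h; apply: dnbhs0_lt; rewrite ltcR.
    by rewrite normr_cabs ltcR.
  have ch0 : 0 < cabs h.
    by rewrite lt_def cabs_ge0 andbT; apply: contra hn0 => /eqP /cabs0_eq0 ->.
  have /fd hfd : cabs h <= 1 by move: hdl; rewrite lt_min => /andP[/ltW].
  rewrite /= normr_cabs ltcE /= ime eqxx /=.
  rewrite (_ : d - _ = - (h^-1 * (f (z + h) - f z - h * d))); last first.
    rewrite /GRing.scale /= mulr1 (addrC z h); field => //.
  rewrite cabsN cabsM cabsV mulrC ltr_pdivrMr//.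
  rewrite (le_lt_trans hfd)//.
  have h1 : cabs h * (`|K| + 1) < Re e.
    by rewrite -ltr_pdivlMr//; move: hdl; rewrite lt_min => /andP[].
  have h2 : K <= `|K| + 1 by rewrite (le_trans (ler_norm _))// lerDl.
  rewrite expr2 -mulrA mulrC ltr_pM2r// (le_lt_trans _ h1)//.
  by rewrite ler_wpM2l ?cabs_ge0.
have dv : derivable (f : C^o -> C^o) (z : C^o) 1 by apply/cvg_ex; exists d.
by split; [exact: dv|exact: (cvg_lim (@norm_hausdorff _ (C^o)) cvgd)].
Unshelve. all: by end_near. Qed.

(* Differentiability with a quadratic remainder: sums, products and termwise
   differentiation then only need elementary estimates. *)
Definition quad_deriv (f f' : C -> C) := forall z, exists K : R, forall h,
  cabs h <= 1 -> cabs (f (z + h) - f z - h * f' z) <= cabs h ^+ 2 * K.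

Lemma quad_deriv_pseriesC M A c : fact_bounded M A c ->
  quad_deriv (pseriesC c) (pseriesC (pderiv c)).
Proof.
move=> cb z; exists (M * A ^+ 2 * expR (A * (cabs z + 1))).
move=> h h1; rewrite {2 3}(_ : h = z + h - z); last by ring.
apply: pseriesC_remainder_le => //; first by rewrite lerDl.
by rewrite (le_trans (cabsD _ _))// lerD.
Qed.

Lemma quad_deriv_is_derive (f f' : C -> C) z : quad_deriv f f' ->
  is_derive (z : C^o) (1 : C^o) (f : C^o -> C^o) (f' z).
Proof. by move=> /(_ z)[K]; exact: is_derive_quadratic. Qed.

Arguments quad_deriv_is_derive {f f'} z _.

(** Evaluation at 0 compares the constant terms; differentiating replaces [c] by [pderiv c], whose
    factor k + 1 can be cancelled. The constants [M] and [N] vary in the induction because [pderiv]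
    changes them. *)
Lemma pseriesC_inj M A N B c d : fact_bounded M A c -> fact_bounded N B d ->
  (forall z, pseriesC c z = pseriesC d z) -> forall k, c k = d k.
Proof.
move=> cb db cd k; elim: k => [|k IH] in M N c d cb db cd *.
  by rewrite -!pseriesC_at0 cd.
suff /(IH _ _ _ _ (fact_bounded_pderiv cb) (fact_bounded_pderiv db))/mulfI :
    forall z, pseriesC (pderiv c) z = pseriesC (pderiv d) z.
  by apply; rewrite pnatr_eq0.
move=> z; have [_ <-] := quad_deriv_is_derive z (quad_deriv_pseriesC cb).
have [_ <-] := quad_deriv_is_derive z (quad_deriv_pseriesC db).
by rewrite (_ : pseriesC c = pseriesC d)//; exact/funext.
Qed.

End PowerSeries.

Arguments psum_cvg {R M A c} z _.
Arguments quad_deriv_is_derive {R f f'} z _.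

(** * The complex exponential *)

Section ExpSum.
Context {F : numFieldType}.
Implicit Types (x y : F).

Definition expsum n x : F := \sum_(k < n) (k`!%:R)^-1 * x ^+ k.

(** Two ways of summing over the triangle i + j < n. *)
Lemma sum_antidiagonals (G : nat -> nat -> F) n :
  \sum_(k < n) \sum_(i < k.+1) G i (k - i)%N =
  \sum_(i < n) \sum_(0 <= j < n - i) G i j.
Proof.
elim: n => [|n IH]; first by rewrite !big_ord0.
rewrite big_ord_recr IH [RHS]big_ord_recr /= subSnn big_nat1.
rewrite [in LHS]big_ord_recr /= subnn addrA -big_split /=; congr (_ + _).
by apply: eq_bigr => i _; rewrite subSn ?(ltnW (ltn_ord i))// big_nat_recr.
Qed.

Lemma expsumD n x y : expsum n (x + y) =
  \sum_(i < n) \sum_(0 <= j < n - i) ((i`!%:R)^-1 * x ^+ i) * ((j`!%:R)^-1 * y ^+ j).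
Proof.
rewrite -(sum_antidiagonals (fun i j => ((i`!%:R)^-1 * x ^+ i) * ((j`!%:R)^-1 * y ^+ j))).
apply: eq_bigr => k _; rewrite addrC exprDn mulr_sumr; apply: eq_bigr => i _.
have ik : (i <= k)%N by rewrite -ltnS.
have fk : k`!%:R = 'C(k, i)%:R * (i`!%:R * (k - i)`!%:R) :> F.
  by rewrite -!natrM bin_fact.
have nz (p : nat) : (p`!%:R : F) != 0 by rewrite pnatr_eq0 -lt0n fact_gt0.
have bz : ('C(k, i)%:R : F) != 0 by rewrite pnatr_eq0 -lt0n bin_gt0.
rewrite fk -(mulr_natr (_ * _)).
move: (nz i) (nz (k - i)%N) bz (x ^+ i) (y ^+ (k - i)).
move: (i`!%:R) ((k - i)`!%:R) ('C(k, i)%:R) => a b c a0 b0 c0 X Y.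
by field; rewrite a0 b0 c0.
Qed.

(** The square i, j < n minus the triangle i + j < n. All remaining monomials have positive
    coefficients, so absolute values can be taken term by term. *)
Lemma expsumM_sub n x y : expsum n x * expsum n y - expsum n (x + y) =
  \sum_(i < n) \sum_(n - i <= j < n) ((i`!%:R)^-1 * x ^+ i) * ((j`!%:R)^-1 * y ^+ j).
Proof.
apply/eqP; rewrite subr_eq expsumD -big_split /= mulr_suml; apply/eqP.
apply: eq_bigr => i _; rewrite mulr_sumr addrC -[in RHS]big_cat_nat ?leq_subr//.
by rewrite big_mkord.
Qed.

End ExpSum.

(** * The exponential series and its sum [cexp] *)

Section ComplexExp.
Context {R : realType}.
Local Notation C := R[i].
Implicit Types (z w a : C).

(* The defect of the exponential law at (z, w) is dominated by the one at
   (|z|, |w|), which tends to 0 by [expRD]. *)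
Lemma expsumM_sub_le n z w :
  cabs (expsum n z * expsum n w - expsum n (z + w)) <=
  expsum n (cabs z) * expsum n (cabs w) - expsum n (cabs z + cabs w).
Proof.
rewrite !expsumM_sub (le_trans (cabs_sum _ _ _))//; apply: ler_sum => i _.
rewrite (le_trans (cabs_sum _ _ _))//; apply: ler_sum => j _.
by rewrite !cabsM !cabsV !cabs_nat !cabsX.
Qed.

Lemma expsum_cvg (x : R) : expsum n x @[n --> \oo] --> expR x.
Proof.
have -> : (fun n => expsum n x) = series (exp_coeff x).
  by apply/funext => n; rewrite /series/= big_mkord; apply: eq_bigr => k _; rewrite mulrC.
exact: is_cvg_series_exp_coeff.
Qed.

Definition expc a : nat -> C := fun k => (k`!%:R)^-1 * a ^+ k.

Lemma fact_bounded_expc a : fact_bounded 1 (cabs a) (expc a).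
Proof.
split; rewrite ?cabs_ge0// => k.
by rewrite mul1r cabsM cabsX cabsV cabs_nat mulrC.
Qed.

Lemma psum_expc a n z : psum (expc a) n z = expsum n (a * z).
Proof. by apply: eq_bigr => k _; rewrite /expc exprMn mulrA. Qed.

Lemma expsum_real n (x : R) : expsum n x%:C = (expsum n x)%:C.
Proof.
rewrite rmorph_sum; apply: eq_bigr => k _.
by rewrite rmorphM fmorphV rmorphXn rmorph_nat.
Qed.

Lemma expsum_imag n (y : R) : expsum n (0 +i* y) =
  series (cos_coeff y) n +i* series (sin_coeff y) n.
Proof.
rewrite /series /= !big_mkord.
have E k : (k`!%:R)^-1 * (0 +i* y) ^+ k = cos_coeff y k +i* sin_coeff y k.
  have -> : (0 +i* y) = 'i%C * y%:C :> C by simpc; rewrite /= ?mulr0 ?mul0r ?mul1r ?subr0 ?addr0.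
  (* Shaped after [cos_coeff] and [sin_coeff]. At k = 0 the truncated [k.-1] does no harm, its
     factor being 0. *)
  have iE : 'i%C ^+ k = ((~~ odd k)%:R * (-1) ^+ k./2) +i* ((odd k)%:R * (-1) ^+ k.-1./2) :> C.
    elim: k => [|k IH]; first by rewrite expr0 /= mulr1 mul0r.
    rewrite exprS IH /= negbK.
    have [ok|ok] := boolP (odd k); simpc => /=; rewrite ?mul0r ?mul1r ?subr0 ?sub0r ?addr0 ?add0r.
      case: k ok {IH} => // k /= ok; congr (_ +i* _).
      by rewrite exprS mulN1r.
    congr (_ +i* _).
  rewrite exprMn iE -rmorphXn.
  have -> : ((k`!%:R)^-1 : C) = ((k`!%:R)^-1 : R)%:C by rewrite fmorphV rmorph_nat.
  rewrite /cos_coeff /sin_coeff /=.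
  by apply: complex_eqP; rewrite /= -?exprnP; ring.
elim: n => [|n IH]; rewrite /expsum ?big_ord0// !big_ord_recr /=.
by rewrite -/(expsum n _) IH E.
Qed.

(** [cexp] is defined through [expR], [cos] and [sin], so its series is known only on the real and
    imaginary axes. Off the axes, the partial sum at [z] differs from the product of the two partial
    sums by [D], which is squeezed to 0 by the same defect at real arguments. *)
Lemma expsum_cvg_cexp z : ((fun n => expsum n z) : nat -> C^o) @ \oo --> (cexp z : C^o).
Proof.
have hx : ((fun n => expsum n (complex.Re z)%:C) : nat -> C^o) @ \oo --> ((expR (complex.Re z))%:C : C^o).
  under eq_fun do rewrite expsum_real.
  by apply: ccvg_ReIm => /=; [exact: expsum_cvg|exact: cvg_cst].
have hy : ((fun n => expsum n (0 +i* complex.Im z)) : nat -> C^o) @ \oo -->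
    (cos (complex.Im z) +i* sin (complex.Im z) : C^o).
  under eq_fun do rewrite expsum_imag.
  apply: ccvg_ReIm => /=; rewrite unlock; [exact: is_cvg_series_cos_coeff|exact: is_cvg_series_sin_coeff].
have zE : z = (complex.Re z)%:C + (0 +i* complex.Im z).
  by case: (z) => a b; apply: complex_eqP; rewrite /= ?addr0 ?add0r.
have hxy := ccvgM hx hy.
set D := fun n => expsum n (complex.Re z)%:C * expsum n (0 +i* complex.Im z) - expsum n z.
have hD : (D : nat -> C^o) @ \oo --> (0 : C^o).
  pose a := cabs ((complex.Re z)%:C : C); pose b := cabs (0 +i* complex.Im z : C).
  apply: (@ccvg_squeeze _ _ _ (fun n => expsum n a * expsum n b - expsum n (a + b))).
    by move=> n; rewrite subr0 /D {3}zE; exact: expsumM_sub_le.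
  rewrite -(subrr (expR (a + b))) {1}expRD.
  by apply: cvgB; [apply: cvgM|]; exact: expsum_cvg.
have -> : (fun n => expsum n z) =
    (fun n => expsum n (complex.Re z)%:C * expsum n (0 +i* complex.Im z) - D n).
  by apply/funext => n; rewrite /D opprB addrC subrK.
by have := ccvgB hxy hD; rewrite subr0.
Qed.

Lemma pseriesC_expc a : pseriesC (expc a) = fun z => cexp (a * z).
Proof.
apply/funext => z; apply: pseriesC_eq.
by under eq_fun do rewrite psum_expc; exact: expsum_cvg_cexp.
Qed.

Lemma cexp0 : cexp (0 : C) = 1.
Proof. by rewrite /cexp /= expR0 cos0 sin0; simpc. Qed.

End ComplexExp.

(** * Integration of complex-valued functions *)

Section ComplexIntegral.
Context d (T : measurableType d) {R : realType}.
Local Notation C := R[i].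
Local Notation Re := (@complex.Re R).
Local Notation Im := (@complex.Im R).
Implicit Types (f g : T -> C).

Definition cmeas f := measurable_fun [set: T] (fun x => Re (f x)) /\
  measurable_fun [set: T] (fun x => Im (f x)).

Lemma cmeasD f g : cmeas f -> cmeas g -> cmeas (fun x => f x + g x).
Proof.
move=> [f1 f2] [g1 g2]; split.
  by under eq_fun do rewrite cReD; exact: measurable_funD.
by under eq_fun do rewrite cImD; exact: measurable_funD.
Qed.

Lemma cmeasM f g : cmeas f -> cmeas g -> cmeas (fun x => f x * g x).
Proof.
move=> [f1 f2] [g1 g2]; split.
  by under eq_fun do rewrite cReM; apply: measurable_funB; exact: measurable_funM.
by under eq_fun do rewrite cImM; apply: measurable_funD; exact: measurable_funM.
Qed.

Lemma cmeas_cst (c : C) : cmeas (fun _ => c).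
Proof. by split; exact: measurable_cst. Qed.

Lemma cmeas_conjc f : cmeas f -> cmeas (fun x => conjc (f x)).
Proof.
have E z : conjc z = Re z +i* - Im z by case: z.
move=> [f1 f2]; split; first by under eq_fun do rewrite E.
by under eq_fun do rewrite E /=; exact: (measurableT_comp (@oppr_measurable R setT)).
Qed.

Lemma cmeas_real (f : T -> R) : measurable_fun [set: T] f -> cmeas (fun x => (f x)%:C).
Proof. by move=> mf; split => //=; exact: measurable_cst. Qed.

Lemma cmeas_sum I (r : seq I) (F : I -> T -> C) : (forall i, cmeas (F i)) ->
  cmeas (fun x => \sum_(i <- r) F i x).
Proof.
move=> mF; elim: r => [|i r IH].
  by under eq_fun do rewrite big_nil; exact: cmeas_cst.
by under eq_fun do rewrite big_cons; exact: cmeasD.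
Qed.

Lemma cmeas_cvg (F : nat -> T -> C) f : (forall n, cmeas (F n)) ->
  (forall x, ((fun n => F n x) : nat -> C^o) @ \oo --> (f x : C^o)) -> cmeas f.
Proof.
move=> mF Ff; split.
  apply: (@measurable_fun_cvg _ _ _ _ (fun n x => Re (F n x))) => [n|x _].
    by case: (mF n).
  exact: ccvg_Re (Ff x).
apply: (@measurable_fun_cvg _ _ _ _ (fun n x => Im (F n x))) => [n|x _].
  by case: (mF n).
exact: ccvg_Im (Ff x).
Qed.

Lemma measurable_cabs f : cmeas f -> measurable_fun [set: T] (fun x => cabs (f x)).
Proof.
move=> [f1 f2].
have -> : (fun x => cabs (f x)) = (fun x => Num.sqrt (Re (f x) ^+ 2 + Im (f x) ^+ 2)).
  by apply/funext => x; rewrite -sqr_cabs sqrtr_sqr ger0_norm ?cabs_ge0.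
apply: measurableT_comp; first exact: (continuous_measurable_fun (@sqrt_continuous R)).
by apply: measurable_funD; exact: measurable_funX.
Qed.

Context (mu : {measure set T -> \bar R}).

Definition cinteg f := mu.-integrable [set: T] (fun x => (Re (f x))%:E) /\
  mu.-integrable [set: T] (fun x => (Im (f x))%:E).

Definition cint f : C :=
  (\int[mu]_(x in [set: T]) Re (f x))%R +i* (\int[mu]_(x in [set: T]) Im (f x))%R.

Lemma le_cinteg f (g : T -> R) : cmeas f -> (forall x, cabs (f x) <= g x) ->
  mu.-integrable [set: T] (fun x => (g x)%:E) -> cinteg f.
Proof.
move=> [f1 f2] fg ig; split; apply: (le_integrable _ _ _ ig) => //.
- exact/measurable_EFinP.
- move=> x _ /=; rewrite lee_fin (le_trans (normr_Re_le _))//.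
  by rewrite (le_trans (fg x))// ler_norm.
- exact/measurable_EFinP.
- move=> x _ /=; rewrite lee_fin (le_trans (normr_Im_le _))//.
  by rewrite (le_trans (fg x))// ler_norm.
Qed.

Lemma cintegD f g : cinteg f -> cinteg g -> cinteg (fun x => f x + g x).
Proof.
move=> [f1 f2] [g1 g2]; split.
  by under eq_fun do rewrite cReD EFinD; exact: integrableD.
by under eq_fun do rewrite cImD EFinD; exact: integrableD.
Qed.

Lemma cintegZ (c : C) f : cinteg f -> cinteg (fun x => c * f x).
Proof.
move=> [f1 f2]; split.
  under eq_fun do rewrite cReM EFinB !EFinM.
  by apply: integrableB => //; exact: integrableZl.
under eq_fun do rewrite cImM EFinD !EFinM.
by apply: integrableD => //; exact: integrableZl.
Qed.

Lemma cinteg0 : cinteg (fun _ => 0).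
Proof. by split; exact: integrable0. Qed.

Lemma cinteg_sum I (r : seq I) (F : I -> T -> C) : (forall i, cinteg (F i)) ->
  cinteg (fun x => \sum_(i <- r) F i x).
Proof.
move=> mF; elim: r => [|i r IH].
  by under eq_fun do rewrite big_nil; exact: cinteg0.
by under eq_fun do rewrite big_cons; exact: cintegD.
Qed.

Lemma cintD f g : cinteg f -> cinteg g ->
  cint (fun x => f x + g x) = cint f + cint g.
Proof.
move=> [f1 f2] [g1 g2]; apply: complex_eqP => /=.
  by under eq_Rintegral do rewrite cReD; rewrite RintegralD.
by under eq_Rintegral do rewrite cImD; rewrite RintegralD.
Qed.

Lemma integrable_realM (k : R) (h : T -> R) :
  mu.-integrable [set: T] (fun x => (h x)%:E) ->
  mu.-integrable [set: T] (fun x => (k * h x)%:E).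
Proof. by move=> /(integrableZl measurableT k). Qed.

Lemma cintZ (c : C) f : cinteg f -> cint (fun x => c * f x) = c * cint f.
Proof.
move=> [f1 f2].
apply: complex_eqP; rewrite (cReM, cImM) /=.
  under eq_Rintegral do rewrite cReM.
  by rewrite RintegralB//; try exact: integrable_realM; rewrite !RintegralZl.
under eq_Rintegral do rewrite cImM.
by rewrite RintegralD//; try exact: integrable_realM; rewrite !RintegralZl.
Qed.

Lemma cint0 : cint (fun _ => 0) = 0.
Proof. by rewrite /cint /= Rintegral_cst//= mul0r. Qed.

Lemma cint_sum I (r : seq I) (F : I -> T -> C) : (forall i, cinteg (F i)) ->
  cint (fun x => \sum_(i <- r) F i x) = \sum_(i <- r) cint (F i).
Proof.
move=> mF; elim: r => [|i r IH].
  rewrite big_nil -[RHS]cint0; congr cint; apply/funext => x.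
  by rewrite big_nil.
rewrite big_cons -IH -cintD//; last exact: cinteg_sum.
by congr cint; apply/funext => x; rewrite big_cons.
Qed.

Lemma cint_conjc f : cinteg f -> cint (fun x => conjc (f x)) = conjc (cint f).
Proof.
have E z : conjc z = Re z +i* - Im z by case: z.
move=> [f1 f2]; rewrite /cint /=.
congr (_ +i* _); first by apply: eq_Rintegral => x _; rewrite E.
rewrite -mulN1r -RintegralZl//.
by apply: eq_Rintegral => x _; rewrite E mulN1r.
Qed.

Lemma cint_cvg (F : nat -> T -> C) f (g : T -> R) : (forall n, cmeas (F n)) ->
  (forall x, ((fun n => F n x) : nat -> C^o) @ \oo --> (f x : C^o)) ->
  (forall n x, cabs (F n x) <= g x) ->
  mu.-integrable [set: T] (fun x => (g x)%:E) ->
  ((fun n => cint (F n)) : nat -> C^o) @ \oo --> (cint f : C^o).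
Proof.
move=> mF Ff Fg ig.
have mf := cmeas_cvg mF Ff.
have fg x : cabs (f x) <= g x by apply: (ccvg_le (Ff x)).
have H (h : C -> R) : (forall u, `|h u| <= cabs u) ->
    (forall n, measurable_fun setT (fun x => h (F n x))) ->
    measurable_fun setT (fun x => h (f x)) ->
    (forall x, h (F n x) @[n --> \oo] --> h (f x)) ->
    (\int[mu]_(x in [set: T]) h (F n x))%R @[n --> \oo] --> (\int[mu]_(x in [set: T]) h (f x))%R.
  move=> hle mh mhf hcvg.
  have ihF n : mu.-integrable [set: T] (fun x => (h (F n x))%:E).
    apply: (le_integrable _ _ _ ig) => //; first exact/measurable_EFinP.
    move=> x _; rewrite lee_fin (le_trans (hle _))// (le_trans (Fg n x))//.
    exact: ler_norm.
  have ihf : mu.-integrable [set: T] (fun x => (h (f x))%:E).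
    apply: (le_integrable _ _ _ ig) => //; first exact/measurable_EFinP.
    move=> x _; rewrite lee_fin (le_trans (hle _))// (le_trans (fg x))//.
    exact: ler_norm.
  apply: fine_cvg; rewrite /Rintegral fineK; last exact: integrable_fin_num.
  have [] := @dominated_convergence _ _ _ mu setT measurableT
    (fun n x => (h (F n x))%:E) (fun x => (h (f x))%:E) (fun x => (g x)%:E) _ _ _ ig _ => //.
  - by move=> n; exact/measurable_EFinP.
  - exact/measurable_EFinP.
  - by apply: aeW => x _; apply: cvg_EFin; [exact: nearW|exact: hcvg].
  - apply: aeW => x n _ /=; rewrite lee_fin (le_trans (hle _))//.
apply: ccvg_ReIm => /=.
- apply: (H Re (@normr_Re_le _)) => [n||x]; [by case: (mF n)|by case: mf|exact: ccvg_Re (Ff x)].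
- apply: (H Im (@normr_Im_le _)) => [n||x]; [by case: (mF n)|by case: mf|exact: ccvg_Im (Ff x)].
Qed.

End ComplexIntegral.

(** * Iterated integrals of complex-valued functions *)

Section ComplexFubini.
Context d1 d2 (T1 : measurableType d1) (T2 : measurableType d2) {R : realType}.
Context (m1 : {sigma_finite_measure set T1 -> \bar R})
  (m2 : {sigma_finite_measure set T2 -> \bar R}).
Local Notation C := R[i].
Implicit Type f : T1 * T2 -> C.

(** Integrability of every section, not only of almost every one, makes the inner extended-real
    integral finite at each point, so that it agrees with the real-valued one used in [cint]. *)
Lemma cint_fubini1 f : cinteg (m1 \x m2)%E f ->
  (forall x, cinteg m2 (fun y => f (x, y))) ->
  cint (m1 \x m2)%E f = cint m1 (fun x => cint m2 (fun y => f (x, y))).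
Proof.
move=> [fr fi] fx; congr (_ +i* _).
  rewrite /Rintegral -integral12_prod_meas1//; congr fine.
  apply: eq_integral => x _; rewrite /fubini_F /= fineK//.
  by apply: integrable_fin_num => //; case: (fx x).
rewrite /Rintegral -integral12_prod_meas1//; congr fine.
apply: eq_integral => x _; rewrite /fubini_F /= fineK//.
by apply: integrable_fin_num => //; case: (fx x).
Qed.

Lemma cint_fubini2 f : cinteg (m1 \x m2)%E f ->
  (forall y, cinteg m1 (fun x => f (x, y))) ->
  cint (m1 \x m2)%E f = cint m2 (fun y => cint m1 (fun x => f (x, y))).
Proof.
move=> [fr fi] fx; congr (_ +i* _).
  rewrite /Rintegral -integral21_prod_meas1//; congr fine.
  apply: eq_integral => x _; rewrite /fubini_G /= fineK//.
  by apply: integrable_fin_num => //; case: (fx x).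
rewrite /Rintegral -integral21_prod_meas1//; congr fine.
apply: eq_integral => x _; rewrite /fubini_G /= fineK//.
by apply: integrable_fin_num => //; case: (fx x).
Qed.

End ComplexFubini.

(** * Gaussian integrals *)

Section GaussianLine.
Context {R : realType}.
Local Notation C := R[i].
Local Notation leb := (@lebesgue_measure R).

Lemma exprn_le_expR (t : R) n : 0 <= t -> t ^+ n <= n`!%:R * expR t.
Proof.
move=> t0; have := exp_partial_le n.+1 t0; rewrite big_ord_recr /= => h.
have f0 : 0 < n`!%:R :> R by rewrite ltr0n fact_gt0.
rewrite mulrC -ler_pdivrMr// (le_trans _ h)// lerDr sumr_ge0// => k _.
by rewrite divr_ge0// exprn_ge0.
Qed.

(** Half of the Gaussian exponent: the other half absorbs exponential growth. Up to a constant it is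
    the standard normal density, whence its integrability. *)
Definition hgauss (x : R) := expR (- x ^+ 2 / 2).

Lemma hgauss_ge0 x : 0 <= hgauss x. Proof. exact: expR_ge0. Qed.

Lemma measurable_hgauss : measurable_fun [set: R] hgauss.
Proof.
have := @measurable_normal_fun R 0 1; rewrite /normal_fun /hgauss.
by under eq_fun do rewrite subr0 expr1n.
Qed.

Lemma integrable_hgauss : leb.-integrable [set: R] (fun x => (hgauss x)%:E).
Proof.
have s0 : (1 : R) != 0 by exact: oner_neq0.
have := @integrable_normal_pdf R 0 1.
rewrite normal_pdfE// => /(integrableZl measurableT (normal_peak 1)^-1).
apply: eq_integrable => // x _ /=.
rewrite -EFinM mulKf; last by rewrite gt_eqF ?normal_peak_gt0.
by rewrite /normal_fun /hgauss subr0 expr1n.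
Qed.

(** Completing the square: the exponents differ by (B - t)^2/2. *)
Lemma gauss_le_hgauss (B t : R) : expR (B * t) * expR (- t ^+ 2) <=
  expR (B ^+ 2 / 2) * expR (- t ^+ 2 / 2).
Proof.
rewrite -!expRD ler_expR -subr_ge0.
rewrite (_ : _ - _ = (B - t) ^+ 2 / 2); last by field.
by rewrite divr_ge0// sqr_ge0.
Qed.

Lemma exprn_gauss_le p (x : R) :
  `|x ^+ p * gauss_fun x| <= p`!%:R * expR (1 / 2) * hgauss x.
Proof.
rewrite normrM normrX (ger0_norm (gauss_fun_ge0 x)).
have := gauss_le_hgauss 1 `|x|; rewrite mul1r expr1n real_normK ?num_real// => h.
rewrite -mulrA (le_trans _ (ler_wpM2l _ h))//.
by rewrite mulrA ler_wpM2r ?gauss_fun_ge0 ?exprn_le_expR.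
Qed.

Lemma measurable_exprn_gauss p : measurable_fun [set: R] (fun x : R => x ^+ p * gauss_fun x).
Proof. by apply: measurable_funM => //; exact: measurable_gauss_fun. Qed.

Lemma integrable_exprn_gauss p :
  leb.-integrable [set: R] (fun x : R => (x ^+ p * gauss_fun x)%:E).
Proof.
apply: (le_integrable measurableT _ _ (integrableZl measurableT (p`!%:R * expR (1 / 2)) integrable_hgauss)).
  by apply/measurable_EFinP; exact: measurable_exprn_gauss.
move=> x _; rewrite -EFinM /= lee_fin (le_trans (exprn_gauss_le p x))//.
exact: ler_norm.
Qed.

(** Serves both ends of the line, [s] being 1 or -1. Since (n - 1)^2 >= 0, [hgauss] at n is at most
    e^{1/2} e^{-n}, which is geometric. *)
Lemma cvg_exprn_gauss p (s : R) : s ^+ 2 = 1 ->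
  (s * n%:R) ^+ p * gauss_fun (s * n%:R) @[n --> \oo] --> (0 : R).
Proof.
move=> s1; pose K : R := p`!%:R * expR (1 / 2) * expR (1 / 2).
apply: (@rcvg_dist _ _ (fun n => K * expR (- 1) ^+ n)).
  move=> n; rewrite subr0 (le_trans (exprn_gauss_le _ _))// /K -[leRHS]mulrA.
  rewrite ler_wpM2l ?mulr_ge0 ?expR_ge0//.
  rewrite /hgauss exprMn s1 mul1r -expRM_natl -expRD ler_expR -subr_ge0.
  rewrite (_ : _ - _ = (n%:R - 1) ^+ 2 / 2); last by field.
  by rewrite divr_ge0// sqr_ge0.
apply: (@cvg_geometric R); rewrite ger0_norm ?expR_ge0// expR_lt1 ltrN10.
Qed.

Let F p (x : R) := x ^+ p * gauss_fun x.
Let f p (x : R) := p%:R * (x ^+ p.-1 * gauss_fun x) - 2 * (x ^+ p.+1 * gauss_fun x).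

Lemma is_derive_exprn_gauss p (x : R) : is_derive x 1 (F p) (f p x).
Proof.
have dg : is_derive x 1 gauss_fun (- (2 * x) * gauss_fun x).
  have d1 : is_derive x (1 : R) (fun t : R => - t ^+ 2) (- (2 * x)).
    by apply: is_derive_eq; rewrite /GRing.scale /= ?mulr1 ?expr1 mulr_natl.
  have := is_derive1_comp (is_derive_expR _) d1.
  by rewrite /GRing.scale /= mulrC.
have dX : is_derive x (1 : R) (fun t : R => t ^+ p) (p%:R * x ^+ p.-1).
  split; first exact: exprn_derivable.
  by rewrite exp_derive /GRing.scale /= mulr1.
have -> : f p x = x ^+ p *: (- (2 * x) * gauss_fun x) + gauss_fun x *: (p%:R * x ^+ p.-1).
  by rewrite /f /GRing.scale /= [x ^+ p.+1]exprS; ring.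
exact: (is_deriveM dX dg).
Qed.

Let measurable_f p : measurable_fun [set: R] (f p).
Proof.
apply: measurable_funB; apply: measurable_funM => //; exact: measurable_exprn_gauss.
Qed.

Let integrable_f p : leb.-integrable [set: R] (fun x => (f p x)%:E).
Proof.
rewrite /f; under eq_fun do rewrite EFinB !EFinM -!EFinM (EFinM p%:R) (EFinM 2).
by apply: integrableB => //; apply: integrableZl => //; exact: integrable_exprn_gauss.
Qed.

Let continuous_f p : continuous (f p).
Proof.
have cX q : continuous (fun x : R => x ^+ q * gauss_fun x).
  by move=> x; apply: cvgM; [exact: exprn_continuous|exact: continuous_gauss_fun].
move=> x; apply: cvgB; apply: cvgM; (try exact: cvg_cst); exact: cX.
Qed.

(** The endpoints are n + 1 in absolute value, so that the interval is nondegenerate even for n =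
    0. *)
Let FTC_f p n : (\int[leb]_(x in `[(- n.+1%:R)%R, n.+1%:R%R]) (f p x)%:E =
  (F p n.+1%:R%R)%:E - (F p (- n.+1%:R)%R)%:E)%E.
Proof.
apply: continuous_FTC2.
- by rewrite gtrN.
- exact/continuous_subspaceT/continuous_f.
- have cF : continuous (F p).
    move=> x; apply: differentiable_continuous; apply/derivable1_diffP.
    by have [] := is_derive_exprn_gauss p x.
  split => [x _||]; first by have [] := is_derive_exprn_gauss p x.
    by apply: cvg_at_right_filter; exact: cF.
  by apply: cvg_at_left_filter; exact: cF.
- by move=> x _; rewrite derive1E; have [_ ->] := is_derive_exprn_gauss p x.
Qed.

Lemma integrable_exprn_gauss_deriv p : leb.-integrable [set: R] (fun x : R =>
  (p%:R * (x ^+ p.-1 * gauss_fun x) - 2 * (x ^+ p.+1 * gauss_fun x))%:E).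
Proof. exact: integrable_f. Qed.

(** The integrand is the derivative of x^p e^{-x^2}. Over growing intervals its integral is a
    difference of boundary values, which vanishes in the limit, and dominated convergence passes to
    the whole line. *)
Lemma Rintegral_exprn_gauss_deriv p : (\int[leb]_(x in [set: R]) f p x)%R = 0.
Proof.
pose h n (x : R) := (f p \_ `[(- n.+1%:R : R), n.+1%:R]) x.
have mh n : measurable_fun [set: R] (h n).
  by apply/(measurable_restrictT _ _).1 => //; apply: measurable_funTS; exact: measurable_f.
have [] := @dominated_convergence _ _ _ leb setT measurableT
    (fun n x => (h n x)%:E) (fun x => (f p x)%:E) (fun x => `|(f p x)%:E|%E).
- by move=> n; apply/measurable_EFinP; exact: mh.
- by apply/measurable_EFinP; exact: measurable_f.
- apply: aeW => x _; apply: cvg_EFin; first exact: nearW.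
  apply: cvg_near_cst; near=> n; have E : h n x = f p x; last by rewrite /= E.
  rewrite /h patchE ifT// inE /= in_itv /=.
  rewrite -ler_norml (@le_trans _ _ n%:R)// ?ler_nat//.
  by near: n; exact: nbhs_infty_ger.
- exact: integrable_abse.
- apply: aeW => x n _ /=; rewrite lee_fin /h patchE.
  by case: ifP => // _; rewrite normr0.
move=> _ _ hcvg; rewrite /Rintegral.
suff : (\int[leb]_(x in [set: R]) (h n x)%:E)%E @[n --> \oo] --> 0%E.
  by move=> h0; have /= -> := cvg_unique (@ereal_hausdorff R) hcvg h0.
have -> : (fun n => (\int[leb]_(x in [set: R]) (h n x)%:E)%E) =
    (fun n => ((1 * n.+1%:R) ^+ p * gauss_fun (1 * n.+1%:R) -
     (- 1 * n.+1%:R) ^+ p * gauss_fun (- 1 * n.+1%:R))%:E).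
  apply/funext => n; rewrite mul1r mulN1r EFinB -FTC_f [RHS]integral_mkcond.
  by apply: eq_integral => x _; rewrite restrict_EFin.
apply: cvg_EFin; first exact: nearW.
rewrite -[X in _ --> X](subrr 0); apply: cvgB.
  rewrite (cvg_shiftS (fun n => (1 * n%:R) ^+ p * gauss_fun (1 * n%:R))).
  by apply: cvg_exprn_gauss; rewrite expr1n.
rewrite (cvg_shiftS (fun n => (- 1 * n%:R) ^+ p * gauss_fun (- 1 * n%:R))).
by apply: cvg_exprn_gauss; rewrite sqrrN expr1n.
Unshelve. all: by end_near. Qed.

End GaussianLine.

(** * Gaussian integration by parts for polynomials on the line *)

Section GaussianPoly.
Context {R : realType}.
Local Notation C := R[i].
Local Notation leb := (@lebesgue_measure R).
Implicit Types (P : {poly C}).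

Lemma cinteg_real d (T : measurableType d) (mu : {measure set T -> \bar R}) (f : T -> R) :
  mu.-integrable [set: T] (fun x => (f x)%:E) -> cinteg mu (fun x => (f x)%:C).
Proof. by move=> fi; split => //=; exact: integrable0. Qed.

Lemma cint_real d (T : measurableType d) (mu : {measure set T -> \bar R}) (f : T -> R) :
  cint mu (fun x => (f x)%:C) = (\int[mu]_(x in [set: T]) f x)%R%:C.
Proof. by rewrite /cint /= Rintegral_cst//= mul0r. Qed.

Lemma cinteg_monomial_gauss k :
  cinteg leb (fun x => x%:C ^+ k * (gauss_fun x)%:C).
Proof.
under eq_fun do rewrite -rmorphXn -rmorphM.
by apply: cinteg_real; exact: integrable_exprn_gauss.
Qed.

Lemma horner_gaussE P (x : R) : P.[x%:C] * (gauss_fun x)%:C =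
  \sum_(i < size P) P`_i * (x%:C ^+ i * (gauss_fun x)%:C).
Proof. by rewrite horner_coef mulr_suml; apply: eq_bigr => i _; rewrite mulrA. Qed.

Lemma cinteg_poly_gauss P : cinteg leb (fun x => P.[x%:C] * (gauss_fun x)%:C).
Proof.
under eq_fun do rewrite horner_gaussE.
by apply: cinteg_sum => i; apply: cintegZ; exact: cinteg_monomial_gauss.
Qed.

(** The difference of the integrands is the derivative of [P] times the Gaussian. It is split into
    monomials because the coefficients are complex while the fundamental theorem was applied to real
    functions. *)
Lemma cint_deriv_gauss P :
  cint leb (fun x => P^`().[x%:C] * (gauss_fun x)%:C) =
  cint leb (fun x => (2 *: ('X * P)).[x%:C] * (gauss_fun x)%:C).
Proof.
have i1 := cinteg_poly_gauss P^`(); have i2 := cinteg_poly_gauss (2 *: ('X * P)).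
apply/eqP; rewrite -subr_eq0 -mulN1r -cintZ// -cintD//; last exact: cintegZ.
have E x : P^`().[x%:C] * (gauss_fun x)%:C + -1 * ((2 *: ('X * P)).[x%:C] * (gauss_fun x)%:C) =
    \sum_(i < size P) P`_i * (i%:R * (x ^+ i.-1 * gauss_fun x) - 2 * (x ^+ i.+1 * gauss_fun x))%:C.
  have hD : P^`().[x%:C] = \sum_(i < size P) P`_i * (i%:R * x%:C ^+ i.-1).
    rewrite -[in LHS](coefK P) poly_def linear_sum horner_sum; apply: eq_bigr => i _.
    by rewrite /= derivZ derivXn hornerZ hornerMn hornerXn mulr_natl.
  rewrite hD hornerZ hornerM hornerX horner_coef !(mulr_suml, mulr_sumr) -big_split /=.
  apply: eq_bigr => i _; rewrite rmorphB !rmorphM /= !rmorphXn !rmorph_nat.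
  by rewrite [_ ^+ i.+1]exprS; ring.
under eq_fun do rewrite E.
apply/eqP; rewrite cint_sum => [|i].
  rewrite big1// => i _; rewrite cintZ; last first.
    by apply: cinteg_real; exact: integrable_exprn_gauss_deriv.
  by rewrite cint_real Rintegral_exprn_gauss_deriv mulr0.
by apply: cintegZ; apply: cinteg_real; exact: integrable_exprn_gauss_deriv.
Qed.

End GaussianPoly.

(** * Functions of exponential growth on the plane, and integration by parts in each variable *)

Section Plane.
Context {R : realType}.
Local Notation C := R[i].
Local Notation leb := (@lebesgue_measure R).
Local Notation Re := (@complex.Re R).
Local Notation Im := (@complex.Im R).
Implicit Types (F G : C -> C) (z : C).

Definition gweight z : C := (expR (- cabs z ^+ 2))%:C.

Lemma gweight_plane (p : R * R) :
  gweight (of_plane p) = (gauss_fun p.1)%:C * (gauss_fun p.2)%:C.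
Proof. by rewrite -rmorphM /= /gauss_fun -expRD /gweight sqr_cabs /= opprD. Qed.

Definition plane_meas F := cmeas
  (fun p : measurableTypeR R * measurableTypeR R => F (of_plane p)).

(** Integrable against the Gaussian, and stable under products and conjugation; analyticity is not
    asked, as conjugates and real parts must be covered. *)
Definition tame F := plane_meas F /\ exists M A : R,
  [/\ 0 <= M, 0 <= A & forall z, cabs (F z) <= M * expR (A * cabs z)].

Lemma tameM F G : tame F -> tame G -> tame (fun z => F z * G z).
Proof.
move=> [mF [M [A [M0 A0 FM]]]] [mG [N [B [N0 B0 GN]]]]; split; first exact: cmeasM.
exists (M * N), (A + B); split; [exact: mulr_ge0|exact: addr_ge0|].
move=> z; rewrite cabsM mulrDl expRD mulrACA.
by rewrite ler_pM ?cabs_ge0.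
Qed.

Lemma tameD F G : tame F -> tame G -> tame (fun z => F z + G z).
Proof.
move=> [mF [M [A [M0 A0 FM]]]] [mG [N [B [N0 B0 GN]]]]; split; first exact: cmeasD.
exists (M + N), (A + B); split; [exact: addr_ge0|exact: addr_ge0|].
move=> z; rewrite (le_trans (cabsD _ _))// mulrDl; apply: lerD.
  rewrite (le_trans (FM z))// ler_wpM2l// ler_expR ler_wpM2r ?cabs_ge0//.
  by rewrite lerDl.
rewrite (le_trans (GN z))// ler_wpM2l// ler_expR ler_wpM2r ?cabs_ge0//.
by rewrite lerDr.
Qed.

Lemma tame_cst (c : C) : tame (fun _ => c).
Proof.
split; first exact: cmeas_cst.
exists (cabs c), 0; split; rewrite ?cabs_ge0// => z.
by rewrite mul0r expR0 mulr1.
Qed.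

Lemma tame_conjc F : tame F -> tame (fun z => conjc (F z)).
Proof.
move=> [mF [M [A [M0 A0 FM]]]]; split; first exact: cmeas_conjc.
by exists M, A; split => // z; rewrite cabs_conjc.
Qed.

Lemma cabs_le_expR z : cabs z <= 1 * expR (1 * cabs z).
Proof. by rewrite !mul1r (le_trans _ (expR_ge1Dx _))// lerDr. Qed.

Lemma tame_id : tame (fun z => z).
Proof.
split; first by split; [exact: measurable_fst|exact: measurable_snd].
by exists 1, 1; split => //; exact: cabs_le_expR.
Qed.

Lemma tame_Re : tame (fun z => (Re z)%:C).
Proof.
split; first by split; [exact: measurable_fst|exact: measurable_cst].
exists 1, 1; split => // z; rewrite cabs_real.
exact: (le_trans (normr_Re_le _) (cabs_le_expR _)).
Qed.

Lemma tame_Im : tame (fun z => (Im z)%:C).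
Proof.
split; first by split; [exact: measurable_snd|exact: measurable_cst].
exists 1, 1; split => // z; rewrite cabs_real.
exact: (le_trans (normr_Im_le _) (cabs_le_expR _)).
Qed.

Lemma tameX F n : tame F -> tame (fun z => F z ^+ n).
Proof.
move=> tF; elim: n => [|n IH]; first exact: tame_cst.
by under eq_fun do rewrite exprS; exact: tameM.
Qed.

Lemma tame_sum I (r : seq I) (F : I -> C -> C) : (forall i, tame (F i)) ->
  tame (fun z => \sum_(i <- r) F i z).
Proof.
move=> tF; elim: r => [|i r IH].
  by under eq_fun do rewrite big_nil; exact: tame_cst.
by under eq_fun do rewrite big_cons; exact: tameD.
Qed.

Lemma tame_horner (P : {poly C}) : tame (fun z => P.[z]).
Proof.
under eq_fun do rewrite horner_coef.
apply: tame_sum => i; apply: tameM; [exact: tame_cst|exact/tameX/tame_id].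
Qed.

Definition hgauss2 (p : R * R) : R := hgauss p.1 * hgauss p.2.

Lemma measurable_hgauss2 :
  measurable_fun [set: measurableTypeR R * measurableTypeR R] hgauss2.
Proof.
by apply: measurable_funM; apply: measurableT_comp => //; exact: measurable_hgauss.
Qed.

Lemma integrable_hgauss2 : area.-integrable [set: R * R] (fun p => (hgauss2 p)%:E).
Proof.
apply/integrableP; split; first by apply/measurable_EFinP; exact: measurable_hgauss2.
have [mh hoo] := integrableP _ _ _ (@integrable_hgauss R).
under eq_integral do rewrite gee0_abs ?lee_fin ?mulr_ge0 ?hgauss_ge0// EFinM.
rewrite (@fubini_tonelli1 _ _ _ _ _ leb leb (fun p => ((hgauss p.1)%:E * (hgauss p.2)%:E)%E))//=; last 2 first.
  by under eq_fun do rewrite -EFinM; apply/measurable_EFinP; exact: measurable_hgauss2.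
  by move=> p; rewrite -EFinM lee_fin mulr_ge0 ?hgauss_ge0.
rewrite /fubini_F /=.
have fin := integrable_fin_num measurableT (@integrable_hgauss R).
under eq_integral do rewrite integralZl ?integrable_hgauss//.
rewrite -(fineK fin); under eq_integral do rewrite muleC.
rewrite integralZl ?integrable_hgauss// lte_mul_pinfty ?ltry//.
- by rewrite lee_fin fine_ge0// integral_ge0// => x _; rewrite lee_fin hgauss_ge0.
- by rewrite ltey_eq fin.
Qed.

Lemma plane_meas_gweight : plane_meas gweight.
Proof.
rewrite /plane_meas; under eq_fun do rewrite gweight_plane.
apply: cmeasM; apply: cmeas_real; apply: measurableT_comp => //; exact: measurable_gauss_fun.
Qed.

(** The majorant behind the dominated convergence in the plane: [gauss_le_hgauss] at t = |z|. *)
Lemma cabsM_gweight_le (M A : R) (w : C) p : 0 <= M ->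
  cabs w <= M * expR (A * cabs (of_plane p)) ->
  cabs (w * gweight (of_plane p)) <= M * expR (A ^+ 2 / 2) * hgauss2 p.
Proof.
move=> M0 wM; rewrite cabsM cabs_real (ger0_norm (expR_ge0 _)).
rewrite (le_trans (ler_wpM2r _ wM)) ?expR_ge0//.
rewrite -[leLHS]mulrA -[leRHS]mulrA ler_wpM2l// (le_trans (gauss_le_hgauss _ _))//.
by rewrite sqr_cabs /= opprD mulrDl [X in _ * X]expRD //.
Qed.

Lemma tame_cinteg F : tame F -> cinteg area (fun p => F (of_plane p) * gweight (of_plane p)).
Proof.
move=> [mF [M [A [M0 A0 FM]]]].
apply: (@le_cinteg _ _ _ area _ (fun p => M * expR (A ^+ 2 / 2) * hgauss2 p)).
- by apply: cmeasM => //; exact: plane_meas_gweight.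
- by move=> p; exact: cabsM_gweight_le.
- by apply: integrable_realM; exact: integrable_hgauss2.
Qed.

Lemma area_fubini1 (f : measurableTypeR R * measurableTypeR R -> C) :
  cinteg area f -> (forall x, cinteg leb (fun y => f (x, y))) ->
  cint area f = cint leb (fun x => cint leb (fun y => f (x, y))).
Proof. exact: (@cint_fubini1 _ _ _ _ _ leb leb). Qed.

Lemma area_fubini2 (f : measurableTypeR R * measurableTypeR R -> C) :
  cinteg area f -> (forall y, cinteg leb (fun x => f (x, y))) ->
  cint area f = cint leb (fun y => cint leb (fun x => f (x, y))).
Proof. exact: (@cint_fubini2 _ _ _ _ _ leb leb). Qed.

(** On each horizontal line [F] is a polynomial in x and [G] its derivative, so after Fubini with x
    innermost this is [cint_deriv_gauss], multiplied by the Gaussian in y. *)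
Lemma ibp_Re (P : R -> {poly C}) F G : tame F -> tame G ->
  (forall x y, F (x +i* y) = (P y).[x%:C]) ->
  (forall x y, G (x +i* y) = (P y)^`().[x%:C]) ->
  cint area (fun p => G (of_plane p) * gweight (of_plane p)) =
  2 * cint area (fun p => (p.1)%:C * F (of_plane p) * gweight (of_plane p)).
Proof.
move=> tF tG FP GP.
have i1 := tame_cinteg tG; have i2 := tame_cinteg (tameM tame_Re tF).
have EG x y : G (of_plane (x, y)) * gweight (of_plane (x, y)) =
    (gauss_fun y)%:C * ((P y)^`().[x%:C] * (gauss_fun x)%:C).
  by rewrite gweight_plane /of_plane /= GP; ring.
have EF x y : 2 * (x%:C * F (of_plane (x, y)) * gweight (of_plane (x, y))) =
    (gauss_fun y)%:C * ((2 *: ('X * P y)).[x%:C] * (gauss_fun x)%:C).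
  by rewrite gweight_plane /of_plane /= FP hornerZ hornerM hornerX; ring.
rewrite -cintZ//.
have -> := area_fubini2 i1.
  have -> := area_fubini2 (cintegZ 2 i2).
    congr cint; apply/funext => y.
    transitivity (cint leb (fun x => (gauss_fun y)%:C * ((P y)^`().[x%:C] * (gauss_fun x)%:C))).
      by congr cint; apply/funext => x; exact: EG.
    rewrite cintZ; last exact: cinteg_poly_gauss.
    rewrite cint_deriv_gauss -cintZ; last exact: cinteg_poly_gauss.
    by congr cint; apply/funext => x; rewrite -EF.
  move=> y; rewrite (_ : (fun _ => _) = (fun x => (gauss_fun y)%:C * ((2 *: ('X * P y)).[x%:C] * (gauss_fun x)%:C))).
    by apply: cintegZ; exact: cinteg_poly_gauss.
  by apply/funext => x; exact: EF.
move=> y; rewrite (_ : (fun _ => _) = (fun x => (gauss_fun y)%:C * ((P y)^`().[x%:C] * (gauss_fun x)%:C))).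
  by apply: cintegZ; exact: cinteg_poly_gauss.
by apply/funext => x; exact: EG.
Qed.

Lemma ibp_Im (P : R -> {poly C}) F G : tame F -> tame G ->
  (forall x y, F (x +i* y) = (P x).[y%:C]) ->
  (forall x y, G (x +i* y) = (P x)^`().[y%:C]) ->
  cint area (fun p => G (of_plane p) * gweight (of_plane p)) =
  2 * cint area (fun p => (p.2)%:C * F (of_plane p) * gweight (of_plane p)).
Proof.
move=> tF tG FP GP.
have i1 := tame_cinteg tG; have i2 := tame_cinteg (tameM tame_Im tF).
have EG x y : G (of_plane (x, y)) * gweight (of_plane (x, y)) =
    (gauss_fun x)%:C * ((P x)^`().[y%:C] * (gauss_fun y)%:C).
  by rewrite gweight_plane /of_plane /= GP; ring.
have EF x y : 2 * (y%:C * F (of_plane (x, y)) * gweight (of_plane (x, y))) =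
    (gauss_fun x)%:C * ((2 *: ('X * P x)).[y%:C] * (gauss_fun y)%:C).
  by rewrite gweight_plane /of_plane /= FP hornerZ hornerM hornerX; ring.
rewrite -cintZ//.
have -> := area_fubini1 i1.
  have -> := area_fubini1 (cintegZ 2 i2).
    congr cint; apply/funext => x.
    transitivity (cint leb (fun y => (gauss_fun x)%:C * ((P x)^`().[y%:C] * (gauss_fun y)%:C))).
      by congr cint; apply/funext => y; exact: EG.
    rewrite cintZ; last exact: cinteg_poly_gauss.
    rewrite cint_deriv_gauss -cintZ; last exact: cinteg_poly_gauss.
    by congr cint; apply/funext => y; rewrite -EF.
  move=> x; rewrite (_ : (fun _ => _) = (fun y => (gauss_fun x)%:C * ((2 *: ('X * P x)).[y%:C] * (gauss_fun y)%:C))).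
    by apply: cintegZ; exact: cinteg_poly_gauss.
  by apply/funext => y; exact: EF.
move=> x; rewrite (_ : (fun _ => _) = (fun y => (gauss_fun x)%:C * ((P x)^`().[y%:C] * (gauss_fun y)%:C))).
  by apply: cintegZ; exact: cinteg_poly_gauss.
by apply/funext => y; exact: EG.
Qed.

End Plane.

Lemma horner_derivXX (K : comNzRingType) (p q : {poly K}) (a b c d x : K) j k :
  p.[x] = a -> q.[x] = b -> p^`().[x] = c -> q^`().[x] = d ->
  (p ^+ j * q ^+ k)^`().[x] =
  c * (j%:R * (a ^+ j.-1 * b ^+ k)) + d * (k%:R * (a ^+ j * b ^+ k.-1)).
Proof.
move=> <- <- <- <-; rewrite derivM !deriv_exp hornerD !hornerM !hornerMn !hornerM !horner_exp.
rewrite -!(mulr_natl (_ * _)).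
move: (p.[x] ^+ j) (p.[x] ^+ j.-1) (q.[x] ^+ k) (q.[x] ^+ k.-1) => A A' B B'.
by move: (j%:R) (k%:R) (p^`().[x]) (q^`().[x]) => n m u v; ring.
Qed.

(** * Gaussian moments of z^j conj(z)^k *)

Section Moments.
Context {R : realType}.
Local Notation C := R[i].
Local Notation leb := (@lebesgue_measure R).
Local Notation Re := (@complex.Re R).
Local Notation Im := (@complex.Im R).
Implicit Types (F G : C -> C) (z : C).

Definition gint F : C := cint area (fun p => F (of_plane p) * gweight (of_plane p)).

Lemma gintD F G : tame F -> tame G -> gint (fun z => F z + G z) = gint F + gint G.
Proof.
move=> /tame_cinteg iF /tame_cinteg iG; rewrite /gint -cintD//.
by congr cint; apply/funext => p; rewrite mulrDl.
Qed.

Lemma gintZ (c : C) F : tame F -> gint (fun z => c * F z) = c * gint F.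
Proof.
move=> /tame_cinteg iF; rewrite /gint -cintZ//.
by congr cint; apply/funext => p; rewrite mulrA.
Qed.

Lemma gint_conjc F : tame F -> gint (fun z => conjc (F z)) = conjc (gint F).
Proof.
move=> /tame_cinteg iF; rewrite /gint -cint_conjc//.
by congr cint; apply/funext => p; rewrite rmorphM /= oppr0.
Qed.

Lemma gint_sum I (r : seq I) (F : I -> C -> C) : (forall i, tame (F i)) ->
  gint (fun z => \sum_(i <- r) F i z) = \sum_(i <- r) gint (F i).
Proof.
move=> tF; rewrite /gint -cint_sum; last by move=> i; exact: tame_cinteg.
by congr cint; apply/funext => p; rewrite mulr_suml.
Qed.

Lemma gint_cvg (F : nat -> C -> C) G (M A : R) : 0 <= M -> 0 <= A ->
  (forall n, plane_meas (F n)) ->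
  (forall n z, cabs (F n z) <= M * expR (A * cabs z)) ->
  (forall z, ((fun n => F n z) : nat -> C^o) @ \oo --> (G z : C^o)) ->
  ((fun n => gint (F n)) : nat -> C^o) @ \oo --> (gint G : C^o).
Proof.
move=> M0 A0 mF FM FG.
apply: (@cint_cvg _ _ _ area (fun n p => F n (of_plane p) * gweight (of_plane p)) _
   (fun p => M * expR (A ^+ 2 / 2) * hgauss2 p)).
- by move=> n; exact: (cmeasM (mF n) plane_meas_gweight).
- by move=> p; apply: ccvgM => //; exact: ccvg_cst.
- by move=> n p; apply: cabsM_gweight_le.
- by apply: integrable_realM; exact: integrable_hgauss2.
Qed.

Definition moment j k := gint (fun z => z ^+ j * conjc z ^+ k).

Lemma tame_moment j k : tame (fun z : C => z ^+ j * conjc z ^+ k).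
Proof. by apply: tameM; apply: tameX; [exact: tame_id|exact/tame_conjc/tame_id]. Qed.

Lemma moment00 : moment 0 0 = pi%:C.
Proof.
have g1 : cint leb (fun x => (gauss_fun x)%:C) = (Num.sqrt pi)%:C.
  by rewrite cint_real /Rintegral integralT_gauss.
have i1 : cinteg leb (fun x => (gauss_fun x)%:C).
  by apply: cinteg_real; exact: integrableT_gauss.
have E x y : (of_plane (x, y)) ^+ 0 * conjc (of_plane (x, y)) ^+ 0 * gweight (of_plane (x, y)) =
    (gauss_fun x)%:C * (gauss_fun y)%:C by rewrite gweight_plane !expr0 !mul1r.
rewrite /moment /gint area_fubini1; last 2 first.
- exact: (tame_cinteg (tame_moment 0 0)).
- move=> x; rewrite (_ : (fun _ => _) = (fun y => (gauss_fun x)%:C * (gauss_fun y)%:C)).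
    exact: cintegZ.
  by apply/funext => y; exact: E.
transitivity (cint leb (fun x => (Num.sqrt pi)%:C * (gauss_fun x)%:C)).
  congr cint; apply/funext => x.
  have H := cintZ (gauss_fun x)%:C i1; rewrite g1 [RHS]mulrC in H.
  by rewrite -H; congr cint; apply/funext => y; exact: E.
by rewrite cintZ// g1 -rmorphM /= -expr2 sqr_sqrtr// pi_ge0.
Qed.

Lemma plane_eta (x y : R) : of_plane (x, y) = x%:C + 'i%C * y%:C.
Proof. by rewrite /of_plane; simpc; rewrite /= ?mulr0 ?mul0r ?mul1r ?subr0 ?addr0 ?add0r. Qed.

(* The integral of d/dz (z^j conj(z)^k exp(-|z|^2)) vanishes, where
   2 d/dz = d/dx - i d/dy. *)
Lemma momentS j k : moment j k.+1 = j%:R * moment j.-1 k.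
Proof.
pose F z : C := z ^+ j * conjc z ^+ k.
pose D1 z : C := j%:R * (z ^+ j.-1 * conjc z ^+ k).
pose D2 z : C := k%:R * (z ^+ j * conjc z ^+ k.-1).
have tD1 : tame D1 by apply: tameM; [exact: tame_cst|exact: tame_moment].
have tD2 : tame D2 by apply: tameM; [exact: tame_cst|exact: tame_moment].
have tF : tame F by exact: tame_moment.
have zE (x y : R) : x +i* y = x%:C + 'i%C * y%:C by exact: plane_eta.
have cE (x y : R) : conjc (x +i* y) = x%:C - 'i%C * y%:C.
  rewrite (_ : conjc _ = x +i* (- y))// zE rmorphN /=; ring.
have HX : gint (fun z => D1 z + D2 z) = 2 * gint (fun z => (Re z)%:C * F z).
  (* For fixed y, z and conj z are polynomials in x with derivative 1; for fixed x, their
     derivatives in y will be i and -i. *)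
  apply: (ibp_Re (P := fun y => ('X + ('i%C * y%:C)%:P) ^+ j * ('X - ('i%C * y%:C)%:P) ^+ k)) => //.
  - exact: tameD.
  - move=> x y; rewrite /F (cE x y) (zE x y) hornerM !horner_exp.
    by rewrite !(hornerD, hornerN, hornerX, hornerC).
  - move=> x y; rewrite /D1 /D2 (cE x y) (zE x y).
    rewrite (@horner_derivXX _ _ _ (x%:C + 'i%C * y%:C) (x%:C - 'i%C * y%:C) 1 1) ?mul1r//.
    + by rewrite hornerD hornerX hornerC.
    + by rewrite hornerD hornerN hornerX hornerC.
    + by rewrite derivD derivX derivC addr0 hornerC.
    + by rewrite derivB derivX derivC subr0 hornerC.
have HY : gint (fun z => 'i%C * D1 z + - 'i%C * D2 z) = 2 * gint (fun z => (Im z)%:C * F z).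
  apply: (ibp_Im (P := fun x => (x%:C%:P + 'i%C *: 'X) ^+ j * (x%:C%:P - 'i%C *: 'X) ^+ k)) => //.
  - by apply: tameD; apply: tameM => //; exact: tame_cst.
  - move=> x y; rewrite /F (cE x y) (zE x y) hornerM !horner_exp.
    by rewrite !(hornerD, hornerN, hornerC, hornerZ, hornerX).
  - move=> x y; rewrite /D1 /D2 (cE x y) (zE x y).
    rewrite (@horner_derivXX _ _ _ (x%:C + 'i%C * y%:C) (x%:C - 'i%C * y%:C) 'i%C (- 'i%C))//.
    + by rewrite hornerD hornerC hornerZ hornerX.
    + by rewrite hornerD hornerN hornerC hornerZ hornerX.
    + by rewrite derivD derivZ derivX derivC add0r hornerZ hornerC mulr1.
    + by rewrite derivB derivZ derivX derivC sub0r hornerN hornerZ hornerC mulr1.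
have i2 : 'i%C * 'i%C = -1 :> C by rewrite -expr2 sqr_i.
have tR : tame (fun z => (Re z)%:C * F z) by apply: tameM => //; exact: tame_Re.
have tI : tame (fun z => (Im z)%:C * F z) by apply: tameM => //; exact: tame_Im.
have -> : moment j k.+1 = gint (fun z => (Re z)%:C * F z) - 'i%C * gint (fun z => (Im z)%:C * F z).
  rewrite -mulNr -gintZ// -gintD//; last by apply: tameM => //; exact: tame_cst.
  congr gint; apply/funext => -[x y].
  rewrite exprS mulrCA -/(F (x +i* y)) (cE x y) -[Re (_ +i* _)]/x -[Im (_ +i* _)]/y.
  by move: (F _) => w; ring.
have -> : j%:R * moment j.-1 k = gint D1 by rewrite /moment -gintZ//; exact: tame_moment.
have two : (2 : C) != 0 by rewrite pnatr_eq0.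
(* [HX] minus i times [HY]: the factor x - iy is conj z, the terms in [D1] add up and those in [D2]
   cancel, conj(z)^k being annihilated by d/dz. *)
apply: (mulfI two); rewrite mulrBr mulrCA -HX -HY.
rewrite gintD// gintD; [|by apply: tameM => //; exact: tame_cst..].
rewrite (gintZ 'i%C tD1) (gintZ (- 'i%C) tD2); move: (gint D1) (gint D2) => a b.
transitivity (a + b - ('i%C * 'i%C) * a + ('i%C * 'i%C) * b); first by ring.
by rewrite i2; ring.
Qed.

Lemma moment_conj j k : moment k j = conjc (moment j k).
Proof.
rewrite /moment -gint_conjc; last exact: tame_moment.
by congr gint; apply/funext => z; rewrite rmorphM !rmorphXn /= conjcK mulrC.
Qed.

(** [momentS] lowers both exponents until one is 0. If only the first is 0, its factor j = 0 kills
    the moment; if only the second is, conjugation swaps the roles. *)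
Lemma momentE j k : moment j k = if j == k then (pi * j`!%:R)%:C else 0.
Proof.
elim: j k => [|j IH] [|k].
- by rewrite moment00 eqxx fact0 mulr1.
- by rewrite momentS mul0r.
- by rewrite moment_conj momentS mul0r conjc0.
rewrite momentS /= IH eqSS; case: ifP => // _; last by rewrite mulr0.
by rewrite factS natrM !rmorphM /= !rmorph_nat; ring.
Qed.

End Moments.

(** * The weighted integral and the reproducing kernel *)

Section Kernel.
Context {R : realType}.
Local Notation C := R[i].
Implicit Types (F G : C -> C) (z w : C) (m : nat).

Lemma conjcM z w : conjc (z * w) = conjc z * conjc w.
Proof. exact: rmorphM. Qed.

Lemma mulcJ z : z * conjc z = (cabs z ^+ 2)%:C.
Proof. by rewrite sqr_cabs; case: z => x y; apply: complex_eqP => /=; ring. Qed.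

Lemma fs_weightE m w : (fs_weight m w)%:C = w ^+ m * conjc w ^+ m * gweight w.
Proof. by rewrite -exprMn mulcJ -rmorphXn -exprM -rmorphM. Qed.

(* <F, 1>_m; the factor |w|^(2m) is written w^m conj(w)^m to keep polynomial
   integrands polynomial in w and conj(w). *)
Definition wint m F : C := ((pi * m`!%:R)^-1)%:C *
  gint (fun w => w ^+ m * conjc w ^+ m * F w).

Lemma tame_weight m F : tame F -> tame (fun w => w ^+ m * conjc w ^+ m * F w).
Proof. by move=> tF; apply: tameM => //; exact: tame_moment. Qed.

Lemma wintE m F : ((pi * m`!%:R)^-1)%:C *
  cintegral (fun w => F w * (fs_weight m w)%:C) = wint m F.
Proof.
congr (_ * _); rewrite /gint.
transitivity (cint area (fun p => F (of_plane p) * (fs_weight m (of_plane p))%:C)) => //.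
congr cint; apply/funext => p; rewrite fs_weightE.
by move: (F _) (gweight _) (_ ^+ m) (_ ^+ m) => a b c d; ring.
Qed.

Arguments tame_weight m {F} _.

Lemma tame_cintegrable m F : tame F ->
  cintegrable (fun w => F w * (fs_weight m w)%:C).
Proof.
move=> /(tame_weight m) /tame_cinteg.
have -> : (fun p => of_plane p ^+ m * (of_plane p)^* ^+ m * F (of_plane p) * gweight (of_plane p)) =
   (fun p => F (of_plane p) * (fs_weight m (of_plane p))%:C).
  apply/funext => p; rewrite fs_weightE.
  by move: (F _) (gweight _) (_ ^+ m) (_ ^+ m) => a b c d; ring.
by [].
Qed.

Lemma wintZ m (c : C) F : tame F -> wint m (fun w => c * F w) = c * wint m F.
Proof.
move=> tF; rewrite /wint mulrCA -(gintZ c (tame_weight m tF)).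
by congr (_ * gint _); apply/funext => w; rewrite mulrCA.
Qed.

Lemma wint_sum m I (r : seq I) (F : I -> C -> C) : (forall i, tame (F i)) ->
  wint m (fun w => \sum_(i <- r) F i w) = \sum_(i <- r) wint m (F i).
Proof.
move=> tF; rewrite /wint -mulr_sumr -gint_sum; last by move=> i; exact: tame_weight.
by congr (_ * gint _); apply/funext => w; rewrite mulr_sumr.
Qed.

Lemma wint_conjc m F : tame F -> wint m (fun w => conjc (F w)) = conjc (wint m F).
Proof.
move=> tF; rewrite /wint.
rewrite conjcM conjc_real -(gint_conjc (tame_weight m tF)); congr (_ * gint _).
by apply/funext => w; rewrite !rmorphM !rmorphXn /= conjcK [_ ^+ m * _ ^+ m]mulrC.
Qed.

Lemma wint_cvg m (F : nat -> C -> C) G (M A : R) : 0 <= M -> 0 <= A ->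
  (forall n, plane_meas (F n)) ->
  (forall n z, cabs (F n z) <= M * expR (A * cabs z)) ->
  (forall z, ((fun n => F n z) : nat -> C^o) @ \oo --> (G z : C^o)) ->
  ((fun n => wint m (F n)) : nat -> C^o) @ \oo --> (wint m G : C^o).
Proof.
move=> M0 A0 mF FM FG; apply: ccvgMl.
have [mw [N [B [N0 B0 wN]]]] := @tame_moment R m m.
apply: (@gint_cvg _ _ _ (N * M) (B + A)).
- exact: mulr_ge0.
- exact: addr_ge0.
- by move=> n; exact: (cmeasM mw (mF n)).
- by move=> n z; rewrite cabsM mulrDl expRD mulrACA ler_pM ?cabs_ge0.
- by move=> z; apply: ccvgMl; exact: FG.
Qed.

Lemma wint_monomial m j k :
  wint m (fun w => w ^+ j * conjc w ^+ k) =
  if j == k then (j + m)`!%:R / m`!%:R else 0.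
Proof.
rewrite /wint (_ : (fun _ => _) = (fun w => w ^+ (j + m) * conjc w ^+ (k + m))); last first.
  apply/funext => w; rewrite !exprD.
  by move: (w ^+ j) (w ^+ m) (_ ^+ k) (_ ^+ m) => a b c d; ring.
rewrite -/(moment _ _) momentE eqn_add2r; case: ifP => _; last by rewrite mulr0.
have p0 : (pi : R) != 0 by rewrite gt_eqF ?pi_gt0.
have f0 : (m`!%:R : R) != 0 by rewrite pnatr_eq0 -lt0n fact_gt0.
rewrite -!(rmorph_nat (real_complex R)) -fmorphV -!rmorphM /=; congr _%:C.
by move: pi p0 (m`!%:R) f0 => p p0 f f0; field; rewrite p0 f0.
Qed.

Definition kcoef m w : nat -> C := fun k => m`!%:R / (k + m)`!%:R * conjc w ^+ k.

Lemma fs_kernelE m z w : fs_kernel m z w = pseriesC (kcoef m w) z.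
Proof.
have E : (fun k => m`!%:R / (k + m)`!%:R * (z * conjc w) ^+ k) = (fun k => kcoef m w k * z ^+ k).
  by apply/funext => k; rewrite /kcoef exprMn -[RHS]mulrA [_ ^+ k * z ^+ k]mulrC.
exact: (congr1 (fun u : nat -> C => lim (series (u : nat -> C^o) @ \oo)) E).
Qed.

(** Equivalent to C(k+m, m) >= 1. Hence the kernel grows no faster than the exponential. *)
Lemma fact_ratio_le m k : (m`!%:R / (k + m)`!%:R : R) <= k`!%:R^-1.
Proof.
have f0 n : 0 < (n`!%:R : R) by rewrite ltr0n fact_gt0.
rewrite ler_pdivrMr// mulrC ler_pdivlMr// -natrM ler_nat.
rewrite -(@bin_fact (k + m) m) ?leq_addl// addnK leq_pmull// bin_gt0 leq_addl//.
Qed.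

Lemma fact_bounded_kcoef m w : fact_bounded 1 (cabs w) (kcoef m w).
Proof.
split; rewrite ?cabs_ge0// => k; rewrite mul1r cabsM cabsX cabs_conjc mulrC.
rewrite ler_wpM2l ?exprn_ge0 ?cabs_ge0//.
by rewrite cabsM cabsV !cabs_nat fact_ratio_le.
Qed.

Lemma psum_kcoefC m z w n : psum (kcoef m w) n z = conjc (psum (kcoef m z) n w).
Proof.
rewrite /psum rmorph_sum; apply: eq_bigr => k _.
by rewrite /kcoef !rmorphM fmorphV !rmorphXn !rmorph_nat /= conjcK mulrAC.
Qed.

Lemma fs_kernelC m z w : fs_kernel m z w = conjc (fs_kernel m w z).
Proof.
rewrite !fs_kernelE; apply: pseriesC_eq.
under eq_fun do rewrite psum_kcoefC.
exact: (ccvg_conjc (psum_cvg w (fact_bounded_kcoef m z))).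
Qed.

Lemma fs_kernel_at0 m z : fs_kernel m z 0 = 1.
Proof.
rewrite fs_kernelC fs_kernelE pseriesC_at0 /kcoef add0n expr0 mulr1 divff ?conjc1 // pnatr_eq0 -lt0n fact_gt0.
Qed.

(** Designed for dominated convergence: identities checked on polynomials pass to the limit under
    the uniform bound. Products are approximated by products of the polynomials. *)
Definition poly_approx F := exists (P : nat -> {poly C}) (M A : R),
  [/\ 0 <= M, 0 <= A, forall n z, cabs (P n).[z] <= M * expR (A * cabs z) &
    forall z, ((fun n => (P n).[z]) : nat -> C^o) @ \oo --> (F z : C^o)].

Lemma poly_approx_tame F : poly_approx F -> tame F.
Proof.
move=> [P [M [A [M0 A0 PM PF]]]]; split.
  apply: (@cmeas_cvg _ _ _ (fun n p => (P n).[of_plane p])) => [n|p]; last exact: PF.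
  by case: (tame_horner (P n)).
by exists M, A; split => // z; apply: (ccvg_le (PF z)).
Qed.

Lemma poly_approxM F G : poly_approx F -> poly_approx G -> poly_approx (fun z => F z * G z).
Proof.
move=> [P [M [A [M0 A0 PM PF]]]] [Q [N [B [N0 B0 QN QG]]]].
exists (fun n => P n * Q n), (M * N), (A + B); split; [exact: mulr_ge0|exact: addr_ge0| |].
  by move=> n z; rewrite hornerM cabsM mulrDl expRD mulrACA ler_pM ?cabs_ge0.
by move=> z; under eq_fun do rewrite hornerM; exact: ccvgM (PF z) (QG z).
Qed.

Lemma poly_approxD F G : poly_approx F -> poly_approx G -> poly_approx (fun z => F z + G z).
Proof.
move=> [P [M [A [M0 A0 PM PF]]]] [Q [N [B [N0 B0 QN QG]]]].
exists (fun n => P n + Q n), (M + N), (A + B); split; [exact: addr_ge0|exact: addr_ge0| |].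
  move=> n z; rewrite hornerD (le_trans (cabsD _ _))// mulrDl; apply: lerD.
    rewrite (le_trans (PM n z))// ler_wpM2l// ler_expR ler_wpM2r ?cabs_ge0//.
    by rewrite lerDl.
  rewrite (le_trans (QN n z))// ler_wpM2l// ler_expR ler_wpM2r ?cabs_ge0//.
  by rewrite lerDr.
by move=> z; under eq_fun do rewrite hornerD; exact: ccvgD (PF z) (QG z).
Qed.

Lemma poly_approx_cst (c : C) : poly_approx (fun _ => c).
Proof.
exists (fun _ => c%:P), (cabs c), 0; split; rewrite ?cabs_ge0//.
  by move=> n z; rewrite hornerC mul0r expR0 mulr1.
by move=> z; under eq_fun do rewrite hornerC; exact: ccvg_cst.
Qed.

Lemma poly_approx_pseriesC (M A : R) c : fact_bounded M A c -> poly_approx (pseriesC c).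
Proof.
move=> cb; have [M0 A0 _] := cb.
have E n z : (\poly_(i < n) c i).[z] = psum c n z by rewrite horner_poly.
exists (fun n => \poly_(i < n) c i), M, A; split => //.
  by move=> n z; rewrite E; exact: psum_le.
by move=> z; under eq_fun do rewrite E; exact: (psum_cvg z cb).
Qed.

Lemma poly_approx_cexp (a : C) : poly_approx (fun z => cexp (a * z)).
Proof. by rewrite -pseriesC_expc; apply: poly_approx_pseriesC; exact: fact_bounded_expc. Qed.

Lemma poly_approx_kernel m w : poly_approx (fun z => fs_kernel m z w).
Proof.
have -> : (fun z => fs_kernel m z w) = pseriesC (kcoef m w).
  by apply/funext => z; rewrite fs_kernelE.
by apply: poly_approx_pseriesC; exact: fact_bounded_kcoef.
Qed.

Lemma tame_kernel m z : tame (fs_kernel m z).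
Proof.
have -> : fs_kernel m z = (fun w => conjc (fs_kernel m w z)).
  by apply/funext => w; rewrite fs_kernelC.
by apply: tame_conjc; apply: poly_approx_tame; exact: poly_approx_kernel.
Qed.

(** Orthogonality keeps only the term of degree [j]. The partial sums have n + j + 1 terms, so each
    contains that degree and the integrals form a constant sequence. *)
Lemma wint_pseries_monomial m (M A : R) c j : fact_bounded M A c ->
  wint m (fun w => pseriesC c w * conjc w ^+ j) = c j * ((j + m)`!%:R / m`!%:R).
Proof.
move=> cb; have [M0 A0 _] := cb.
pose F n w : C := psum c (n + j.+1) w * conjc w ^+ j.
have tj : tame (fun w : C => conjc w ^+ j) by exact/tameX/tame_conjc/tame_id.
have tp n : tame (fun w => psum c n w).
  by apply: tame_sum => k; apply: tameM; [exact: tame_cst|exact/tameX/tame_id].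
have H : ((fun n => wint m (F n)) : nat -> C^o) @ \oo -->
    (wint m (fun w => pseriesC c w * conjc w ^+ j) : C^o).
  have [_ [N [B [N0 B0 wN]]]] := tj.
  apply: (@wint_cvg _ _ _ (M * N) (A + B)).
  - exact: mulr_ge0.
  - exact: addr_ge0.
  - by move=> n; have [] := tameM (tp (n + j.+1)%N) tj.
  - move=> n w; rewrite cabsM mulrDl expRD mulrACA ler_pM ?cabs_ge0//.
    exact: psum_le cb.
  - move=> w; apply: ccvgM; last exact: ccvg_cst.
    rewrite (@cvg_shiftn j.+1 _ (fun n => psum c n w : C^o)).
    exact: (psum_cvg w cb).
apply: (ccvg_unique H).
rewrite (_ : (fun n => _) = (fun _ => c j * ((j + m)`!%:R / m`!%:R))); first exact: ccvg_cst.
apply/funext => n.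
have -> : F n = (fun w => \sum_(k < n + j.+1) c k * (w ^+ k * conjc w ^+ j)).
  by apply/funext => w; rewrite /F /psum mulr_suml; apply: eq_bigr => k _; rewrite mulrA.
rewrite wint_sum => [|k]; last by apply: tameM; [exact: tame_cst|exact: tame_moment].
have jn : (j < n + j.+1)%N by rewrite addnS ltnS leq_addl.
rewrite (bigD1 (Ordinal jn))//= big1 ?addr0 => [|k kj].
  by rewrite wintZ ?wint_monomial ?eqxx//; exact: tame_moment.
rewrite wintZ; last exact: tame_moment.
by rewrite wint_monomial ifF ?mulr0//; exact: negbTE.
Qed.

(** After conjugation the kernel is a power series in w, and its coefficient m!/(j+m)! cancels the
    squared norm (j+m)!/m! of w^j. *)
Lemma wint_kernel_monomial m z j :
  wint m (fun w => w ^+ j * fs_kernel m z w) = z ^+ j.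
Proof.
have cb := fact_bounded_kcoef m z.
have -> : (fun w => w ^+ j * fs_kernel m z w) =
    (fun w => conjc (pseriesC (kcoef m z) w * conjc w ^+ j)).
  apply/funext => w; rewrite conjcM rmorphXn /= conjcK fs_kernelC fs_kernelE.
  exact: mulrC.
rewrite wint_conjc; last first.
  apply: tameM; first by apply: poly_approx_tame; exact: poly_approx_pseriesC cb.
  exact/tameX/tame_conjc/tame_id.
rewrite (wint_pseries_monomial m j cb) /kcoef !rmorphM !fmorphV !rmorph_nat rmorphXn /= conjcK.
have f0 : (m`!%:R : C) != 0 by rewrite pnatr_eq0 -lt0n fact_gt0.
have g0 : ((j + m)`!%:R : C) != 0 by rewrite pnatr_eq0 -lt0n fact_gt0.
by move: (m`!%:R) f0 ((j + m)`!%:R) g0 => f f0 g g0; field; rewrite f0.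
Qed.

(** For polynomials this is [wint_kernel_monomial] by linearity; the general case is a dominated
    limit. *)
Lemma reproducing m F z : poly_approx F -> wint m (fun w => F w * fs_kernel m z w) = F z.
Proof.
move=> [P [M [A [M0 A0 PM PF]]]].
have [mk [N [B [N0 B0 kN]]]] := @tame_kernel m z.
have H : ((fun n => wint m (fun w => (P n).[w] * fs_kernel m z w)) : nat -> C^o) @ \oo -->
    (wint m (fun w => F w * fs_kernel m z w) : C^o).
  apply: (@wint_cvg _ _ _ (M * N) (A + B)).
  - exact: mulr_ge0.
  - exact: addr_ge0.
  - by move=> n; have [mP _] := tame_horner (P n); exact: cmeasM.
  - by move=> n w; rewrite cabsM mulrDl expRD mulrACA ler_pM ?cabs_ge0.
  - by move=> w; apply: ccvgM (PF w) _; exact: ccvg_cst.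
apply: (ccvg_unique H).
rewrite (_ : (fun n => _) = (fun n => (P n).[z])); first exact: PF.
apply/funext => n.
have -> : (fun w => (P n).[w] * fs_kernel m z w) =
    (fun w => \sum_(k < size (P n)) (P n)`_k * (w ^+ k * fs_kernel m z w)).
  by apply/funext => w; rewrite horner_coef mulr_suml; apply: eq_bigr => k _; rewrite mulrA.
have t k : tame (fun w => w ^+ k * fs_kernel m z w).
  by apply: tameM; [exact/tameX/tame_id|exact: tame_kernel].
rewrite wint_sum => [|k]; last by apply: tameM; [exact: tame_cst|exact: t].
rewrite horner_coef; apply: eq_bigr => k _.
by rewrite wintZ// wint_kernel_monomial.
Qed.

End Kernel.

(** * Toeplitz operators on the span of the kernels *)

Section Smooth.
Context {R : realType}.
Local Notation C := R[i].
Implicit Types (F G : C -> C) (z w : C) (m n : nat).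

Lemma quad_derivD F G F' G' : quad_deriv F F' -> quad_deriv G G' ->
  quad_deriv (fun z => F z + G z) (fun z => F' z + G' z).
Proof.
move=> hF hG z; have [K hK] := hF z; have [L hL] := hG z.
exists (K + L) => h h1.
rewrite (_ : _ - _ - _ = (F (z + h) - F z - h * F' z) + (G (z + h) - G z - h * G' z)); last by ring.
by rewrite (le_trans (cabsD _ _))// [leRHS]mulrDr lerD ?hK ?hL.
Qed.

Lemma quad_derivM F G F' G' : quad_deriv F F' -> quad_deriv G G' ->
  quad_deriv (fun z => F z * G z) (fun z => F' z * G z + F z * G' z).
Proof.
move=> hF hG z; have [K hK] := hF z; have [L hL] := hG z.
pose a := cabs (F z); pose a' := cabs (F' z); pose b := cabs (G z); pose b' := cabs (G' z).
exists (a' * b' + K * (b + b' + L) + L * (a + a')) => h h1.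
have {hK} := hK h h1; have {hL} := hL h h1.
set r := F (z + h) - F z - h * F' z; set s := G (z + h) - G z - h * G' z => hs hr.
have -> : F (z + h) * G (z + h) - F z * G z - h * (F' z * G z + F z * G' z) =
    h ^+ 2 * (F' z * G' z) + r * (G z + h * G' z + s) + s * (F z + h * F' z).
  by rewrite /r /s; ring.
have h2 : cabs h ^+ 2 <= 1 by rewrite exprn_ile1 ?cabs_ge0.
(* No sign is given for the remainder constants, but at a nonzero [h] the hypothesis itself forces
   [0 <= L]. *)
have L0 : 0 <= L \/ h = 0.
  have [/cabs0_eq0|h0] := eqVneq (cabs h) 0; [by right|left].
  have h20 : 0 < cabs h ^+ 2 by rewrite exprn_gt0// lt_def h0 cabs_ge0.
  by rewrite -(pmulr_rge0 _ h20) (le_trans (cabs_ge0 s)).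
case: L0 => [L0|h0]; last first.
  have -> : r = 0 by rewrite /r h0 addr0 mul0r subr0 subrr.
  have -> : s = 0 by rewrite /s h0 addr0 mul0r subr0 subrr.
  by rewrite h0 cabs0 !expr0n /= !mul0r !addr0 cabs0.
have hG' : cabs (G z + h * G' z + s) <= b + b' + L.
  rewrite (le_trans (cabsD _ _))// lerD//.
    rewrite (le_trans (cabsD _ _))// lerD// cabsM ler_piMl ?cabs_ge0//.
  by rewrite (le_trans hs)// ler_piMl.
have hF' : cabs (F z + h * F' z) <= a + a'.
  by rewrite (le_trans (cabsD _ _))// lerD// cabsM ler_piMl ?cabs_ge0.
rewrite (le_trans (cabsD _ _))// [leRHS]mulrDr lerD//.
  rewrite (le_trans (cabsD _ _))// [leRHS]mulrDr lerD//; first by rewrite cabsM cabsX [cabs (F' z * _)]cabsM.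
  by rewrite cabsM [leRHS]mulrA ler_pM ?cabs_ge0.
by rewrite cabsM [leRHS]mulrA ler_pM ?cabs_ge0.
Qed.

Lemma quad_deriv_cst (c : C) : quad_deriv (fun _ => c) (fun _ => 0).
Proof. by move=> z; exists 0 => h _; rewrite subrr mulr0 subrr cabs0 mulr0. Qed.

(* Closed under products without any Cauchy product of coefficients, and
   [smooth m] functions lie in F^(2,m). *)
Fixpoint smooth n F : Prop := poly_approx F /\ exists F', quad_deriv F F' /\
  if n is n'.+1 then smooth n' F' else True.

Lemma smooth_poly_approx n F : smooth n F -> poly_approx F.
Proof. by case: n => [|n] []. Qed.

Lemma smoothW n F : smooth n.+1 F -> smooth n F.
Proof.
elim: n F => [|n IH] F [aF [F' [dF sF']]]; split => //; exists F'; split => //.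
exact: IH.
Qed.

Lemma smoothD n F G : smooth n F -> smooth n G -> smooth n (fun z => F z + G z).
Proof.
elim: n F G => [|n IH] F G [aF [F' [dF sF]]] [aG [G' [dG sG]]].
  by split; [exact: poly_approxD|exists (fun z => F' z + G' z); split => //; exact: quad_derivD].
split; first exact: poly_approxD.
by exists (fun z => F' z + G' z); split; [exact: quad_derivD|exact: IH].
Qed.

Lemma smoothM n F G : smooth n F -> smooth n G -> smooth n (fun z => F z * G z).
Proof.
elim: n F G => [|n IH] F G sF0 sG0.
  case: sF0 sG0 => [aF [F' [dF sF]]] [aG [G' [dG sG]]].
  split; [exact: poly_approxM|exists (fun z => F' z * G z + F z * G' z); split => //].
  exact: quad_derivM.
have [aF [F' [dF sF]]] := sF0; have [aG [G' [dG sG]]] := sG0.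
split; first exact: poly_approxM.
exists (fun z => F' z * G z + F z * G' z); split; first exact: quad_derivM.
(* In the Leibniz rule a derivative, of order n, meets an undifferentiated factor of order n + 1;
   [smoothW] brings both to order n. *)
by apply: smoothD; apply: IH => //; exact: smoothW.
Qed.

Lemma smooth_cst n (c : C) : smooth n (fun _ => c).
Proof.
elim: n c => [|n IH] c; (split; first exact: poly_approx_cst);
  by exists (fun _ => 0); split => //; exact: quad_deriv_cst.
Qed.

Lemma smooth_sum n I (r : seq I) (F : I -> C -> C) : (forall i, smooth n (F i)) ->
  smooth n (fun z => \sum_(i <- r) F i z).
Proof.
move=> sF; elim: r => [|i r IH].
  rewrite (_ : (fun _ => _) = (fun _ => 0)); first exact: smooth_cst.
  by apply/funext => z; rewrite big_nil.
rewrite (_ : (fun _ => _) = (fun z => F i z + \sum_(i <- r) F i z)); first exact: smoothD.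
by apply/funext => z; rewrite big_cons.
Qed.

Lemma smooth_pseriesC n (M A : R) c : fact_bounded M A c -> smooth n (pseriesC c).
Proof.
elim: n M c => [|n IH] M c cb; (split; first exact: poly_approx_pseriesC cb);
  exists (pseriesC (pderiv c)); split => //; try exact: quad_deriv_pseriesC cb.
exact: IH (fact_bounded_pderiv cb).
Qed.

Lemma smooth_cexp n (a : C) : smooth n (fun z => cexp (a * z)).
Proof. by rewrite -pseriesC_expc; apply: smooth_pseriesC (fact_bounded_expc a). Qed.

Lemma smooth_kernel n m w : smooth n (fun z => fs_kernel m z w).
Proof.
have -> : (fun z => fs_kernel m z w) = pseriesC (kcoef m w).
  by apply/funext => z; rewrite fs_kernelE.
exact: smooth_pseriesC (fact_bounded_kcoef m w).
Qed.

Lemma smooth_entire n F : smooth n F -> entire F.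
Proof.
by case: n => [|n] [_ [F' [dF _]]] z; have [] := quad_deriv_is_derive z dF.
Qed.

Lemma smooth_nth_derivative n F : smooth n F -> smooth 0 (nth_derivative n F).
Proof.
rewrite /nth_derivative; elim: n F => [//|n IH] F [_ [F' [dF sF]]].
rewrite derive1Sn (_ : derive1 _ = (F' : C^o -> C^o)); first exact: IH.
apply/funext => z; rewrite derive1E.
by have [_ ->] := quad_deriv_is_derive z dF.
Qed.

Lemma tame_integrable F : tame F -> area.-integrable [set: R * R]
  (fun p => (cabs (F (of_plane p)) * expR (- cabs (of_plane p) ^+ 2))%:E).
Proof.
move=> [mF [M [A [M0 A0 FM]]]].
have E p : cabs (F (of_plane p)) * expR (- cabs (of_plane p) ^+ 2) =
    cabs (F (of_plane p) * gweight (of_plane p)).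
  by rewrite cabsM /gweight cabs_real ger0_norm ?expR_ge0.
have iK : area.-integrable [set: R * R]
    (fun p => (M * expR (A ^+ 2 / 2) * hgauss2 p)%:E).
  by apply: integrable_realM; exact: integrable_hgauss2.
apply: (le_integrable _ _ _ iK) => //.
  apply/measurable_EFinP.
  rewrite (_ : (fun _ => _) = (fun p => cabs (F (of_plane p) * gweight (of_plane p)))).
    exact: (measurable_cabs (cmeasM mF plane_meas_gweight)).
  by apply/funext => p; exact: E.
move=> p _ /=; rewrite lee_fin E (ger0_norm (cabs_ge0 _)).
by rewrite (le_trans _ (ler_norm _))// cabsM_gweight_le.
Qed.

Lemma tame_integral_lty F : tame F -> (\int[area]_(p in [set: R * R])
  (cabs (F (of_plane p)) * expR (- cabs (of_plane p) ^+ 2))%:E < +oo)%E.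
Proof.
move=> /tame_integrable /integrableP[_]; apply: le_lt_trans.
rewrite le_eqVlt; apply/orP; left; apply/eqP; apply: eq_integral => p _.
by rewrite gee0_abs// lee_fin mulr_ge0 ?cabs_ge0 ?expR_ge0.
Qed.

(** The m-th derivative still grows at most exponentially, and so does its square. *)
Lemma smooth_FockSobolev m F : smooth m F -> FockSobolev m F.
Proof.
move=> sF; split; first exact: smooth_entire sF.
have s0 := smooth_nth_derivative sF; split; first exact: smooth_entire s0.
have tG := poly_approx_tame (smooth_poly_approx s0).
rewrite lte_mul_pinfty ?lee_fin ?invr_ge0 ?pi_ge0//.
have := tame_integral_lty (tameM tG tG); apply: le_lt_trans.
rewrite le_eqVlt; apply/orP; left; apply/eqP; apply: eq_integral => p _.
by rewrite cabsM.
Qed.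

End Smooth.

(** * Analytic and conjugate-analytic symbols *)

Section Toeplitz.
Context {R : realType}.
Local Notation C := R[i].
Implicit Types (F G phi f : C -> C) (z w : C) (m n : nat).

Lemma toeplitz_wint m phi f z :
  toeplitz m phi f z = wint m (fun w => phi w * f w * fs_kernel m z w).
Proof. by rewrite -wintE. Qed.

Lemma tame_toeplitz_symbol m phi : tame phi -> toeplitz_symbol m phi.
Proof.
move=> tphi; split; first by case: tphi.
move=> z; have := tame_integral_lty (tame_weight m (tameM tphi (tame_kernel m z))).
apply: le_lt_trans; rewrite le_eqVlt; apply/orP; left; apply/eqP.
apply: eq_integral => p _; congr EFin; rewrite /fs_weight !cabsM !cabsX cabs_conjc.
rewrite mul2n -addnn exprD; move: (cabs (phi _)) (cabs (fs_kernel _ _ _)) (expR _) (_ ^+ m).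
by move=> a b c d; ring.
Qed.

Lemma smooth_toeplitz_domain m phi f : tame phi -> smooth m f ->
  smooth m (toeplitz m phi f) -> toeplitz_domain m phi f.
Proof.
move=> tphi sf sT; split; [exact: tame_toeplitz_symbol|exact: smooth_FockSobolev| |exact: smooth_FockSobolev].
move=> z; apply: tame_cintegrable; apply: tameM; last exact: tame_kernel.
by apply: tameM => //; apply: poly_approx_tame; exact: smooth_poly_approx sf.
Qed.

Lemma toeplitz_analytic m phi f : poly_approx phi -> poly_approx f ->
  toeplitz m phi f = fun z => phi z * f z.
Proof.
move=> aphi af; apply/funext => z; rewrite toeplitz_wint.
exact: (reproducing m z (poly_approxM aphi af)).
Qed.

(** By Hermitian symmetry of the kernel the integrand is the conjugate of g K(., z) times K(w, .),
    so the reproducing property is applied at [w] instead of [z]. *)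
Lemma toeplitz_conjc_kernel m g w z : poly_approx g ->
  toeplitz m (fun u => conjc (g u)) (fun u => fs_kernel m u w) z =
  conjc (g w) * fs_kernel m z w.
Proof.
move=> ag; rewrite toeplitz_wint.
have -> : (fun u => conjc (g u) * fs_kernel m u w * fs_kernel m z u) =
    (fun u => conjc (g u * fs_kernel m u z * fs_kernel m w u)).
  apply/funext => u; rewrite (fs_kernelC m u w) (fs_kernelC m z u).
  by rewrite !conjcM; exact: mulrAC.
have aG : poly_approx (fun u => g u * fs_kernel m u z).
  exact: (poly_approxM ag (poly_approx_kernel m z)).
rewrite wint_conjc; last by apply: tameM; [exact: poly_approx_tame|exact: tame_kernel].
by rewrite (reproducing m w aG) conjcM -fs_kernelC.
Qed.

Lemma toeplitz_conjc_span m g (c : C -> C) (s : seq C) : poly_approx g ->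
  toeplitz m (fun u => conjc (g u)) (fun u => \sum_(w <- s) c w * fs_kernel m u w) =
  fun z => \sum_(w <- s) (c w * conjc (g w)) * fs_kernel m z w.
Proof.
move=> ag; apply/funext => z; rewrite toeplitz_wint.
have -> : (fun u => conjc (g u) * (\sum_(w <- s) c w * fs_kernel m u w) * fs_kernel m z u) =
    (fun u => \sum_(w <- s) c w * (conjc (g u) * fs_kernel m u w * fs_kernel m z u)).
  apply/funext => u; rewrite mulr_sumr mulr_suml; apply: eq_bigr => w _.
  by rewrite mulrCA; exact/esym/mulrA.
have t w : tame (fun u => conjc (g u) * fs_kernel m u w * fs_kernel m z u).
  apply: tameM; last exact: tame_kernel; apply: tameM.
    by apply: tame_conjc; exact: poly_approx_tame.
  by apply: poly_approx_tame; exact: poly_approx_kernel.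
rewrite wint_sum => [|w]; last by apply: tameM => //; exact: tame_cst.
apply: eq_bigr => w _; rewrite wintZ//.
by rewrite -toeplitz_wint toeplitz_conjc_kernel// mulrA.
Qed.

Lemma smooth_span n m (c : C -> C) (s : seq C) :
  smooth n (fun u => \sum_(w <- s) c w * fs_kernel m u w).
Proof.
apply: smooth_sum => w; apply: smoothM; [exact: smooth_cst|exact: smooth_kernel].
Qed.

Lemma kernel_spanP m f : kernel_span m f ->
  exists s (c : C -> C), f = fun u => \sum_(w <- s) c w * fs_kernel m u w.
Proof. by move=> [s [c fE]]; exists s, c; apply/funext. Qed.

Lemma toeplitz_prod_eq_of_mul0 m (a b : C) : a * b = 0 ->
  toeplitz_prod_eq m (fun z => cexp (a * z)) (fun z => conjc (cexp (b * z)))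
    (fun z => cexp (a * z) * conjc (cexp (b * z))).
Proof.
move=> ab f /kernel_spanP[s [c ->]].
have aa := poly_approx_cexp a; have a_b := poly_approx_cexp b.
pose f0 c := fun u => \sum_(w <- s) c w * fs_kernel m u w.
(* The conjugate symbol preserves the span on the same points and only changes the coefficients from
   [c] to [c']. *)
pose c' w := c w * conjc (cexp (b * w)).
have sf c0 : smooth m (f0 c0) by exact: smooth_span.
have T1 := toeplitz_conjc_span m c s a_b.
have T2 c0 : toeplitz m (fun z => cexp (a * z)) (f0 c0) = fun z => cexp (a * z) * f0 c0 z.
  exact: (toeplitz_analytic m aa (smooth_poly_approx (sf c0))).
have D1 : toeplitz_domain m (fun z => conjc (cexp (b * z))) (f0 c).
  apply: (smooth_toeplitz_domain (tame_conjc (poly_approx_tame a_b)) (sf c)).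
  rewrite T1; exact: (sf c').
have D2 c0 : toeplitz_domain m (fun z => cexp (a * z)) (f0 c0).
  apply: (smooth_toeplitz_domain (poly_approx_tame aa) (sf c0)).
  rewrite T2; exact: (smoothM (smooth_cexp m a) (sf c0)).
have [a0|b0] : a = 0 \/ b = 0 by move/eqP: ab; rewrite mulf_eq0 => /orP[] /eqP; auto.
- have chiE : (fun z => cexp (a * z) * conjc (cexp (b * z))) = (fun z => conjc (cexp (b * z))).
    by apply/funext => z; rewrite a0 mul0r cexp0 mul1r.
  rewrite chiE; split; [exact: D1|rewrite T1; exact: (D2 c')|exact: D1|].
  by move=> z; rewrite T1 (T2 c') a0 mul0r cexp0 mul1r.
- have chiE : (fun z => cexp (a * z) * conjc (cexp (b * z))) = (fun z => cexp (a * z)).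
    by apply/funext => z; rewrite b0 mul0r cexp0 conjc1 mulr1.
  have T1' : toeplitz m (fun u => conjc (cexp (b * u))) (f0 c) = f0 c.
    rewrite T1; apply/funext => z; apply: eq_bigr => w _.
    by rewrite b0 mul0r cexp0 conjc1 mulr1.
  by rewrite chiE T1'; split; [exact: D1|exact: D2|exact: D2|].
Qed.

End Toeplitz.

(** * Coefficients of the Toeplitz operator of a product symbol *)

Section Coefficients.
Context {R : realType}.
Local Notation C := R[i].
Implicit Types (z w x a b : C) (m n k : nat).

(** Partial sums of the series in the binomial identity, with upper index n + k rather than n + m +
    k, so that lowering [m] leaves [n] in place. *)
Definition binser x m n N : C := \sum_(k < N) (k`!%:R)^-1 * x ^+ k * 'C(n + k, m)%:R.

Lemma binserS x m n N : binser x m n N = binser x m.+1 n.+1 N - binser x m.+1 n N.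
Proof.
rewrite /binser -sumrB; apply: eq_bigr => k _.
by rewrite addSn binS natrD mulrDr addrAC subrr add0r.
Qed.

(* Differencing in [n] lowers the binomial degree by Pascal's rule. *)
Lemma binser_step x m n0 :
  (forall n, (n0 <= n)%N -> (binser x m.+1 n : nat -> C^o) @ \oo --> ('C(n, m.+1)%:R : C^o)) ->
  forall n, (n0 <= n)%N -> (binser x m n : nat -> C^o) @ \oo --> ('C(n, m)%:R : C^o).
Proof.
move=> H n n0n; have h := ccvgB (H n.+1 (leqW n0n)) (H n n0n).
have -> : ('C(n, m)%:R : C) = 'C(n.+1, m.+1)%:R - 'C(n, m.+1)%:R.
  by rewrite binS natrD addrAC subrr add0r.
rewrite (_ : binser x m n = (fun N => binser x m.+1 n.+1 N - binser x m.+1 n N))//.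
by apply/funext => N; exact: binserS.
Qed.

Lemma binser_eq0 x m n0 : (0 < m)%N ->
  (forall n, (n0 <= n)%N -> (binser x m n : nat -> C^o) @ \oo --> ('C(n, m)%:R : C^o)) ->
  x = 0.
Proof.
case: m => // m _; elim: m => [|m IH] H; last by apply: IH; exact: binser_step H.
have h1 := H n0 (leqnn _); have h0 := binser_step H (leqnn n0).
(* In degree 1 the binomial is n0 + k. What is left is the sum of k x^k/k!, which after an index
   shift is x times the degree 0 series; the latter tends to 1. *)
have E N : binser x 1 n0 N - n0%:R * binser x 0 n0 N =
    \sum_(k < N) (k`!%:R)^-1 * x ^+ k * k%:R.
  rewrite /binser mulr_sumr -sumrB; apply: eq_bigr => k _.
  by rewrite bin1 bin0 natrD; ring.
have := ccvgB h1 (ccvgMl n0%:R h0); rewrite bin1 bin0 mulr1 subrr => h2.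
have h3 : ((fun N => x * binser x 0 n0 N) : nat -> C^o) @ \oo --> (0 : C^o).
  rewrite -(@cvg_shiftn 1 _ (fun N => binser x 1 n0 N - n0%:R * binser x 0 n0 N : C^o)) in h2.
  rewrite (_ : (fun N => _) = (fun N => binser x 1 n0 (N + 1) - n0%:R * binser x 0 n0 (N + 1)))//.
  apply/funext => N; rewrite E addn1 big_ord_recl mulr0 add0r /binser mulr_sumr.
  apply: eq_bigr => k _; rewrite bin0 mulr1 /= /bump /= add1n factS natrM exprS.
  have f0 : (k`!%:R : C) != 0 by rewrite pnatr_eq0 -lt0n fact_gt0.
  have k0 : (k.+1%:R : C) != 0 by rewrite pnatr_eq0.
  by move: (k`!%:R) f0 (k.+1%:R) k0 (x ^+ k) => f f0 g g0 y; field; rewrite f0.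
have := ccvg_unique h3 (ccvgMl x h0); rewrite bin0 mulr1.
by move=> <-.
Qed.

Lemma bin_le_exp n k : ('C(n, k) <= 2 ^ n)%N.
Proof.
elim: n k => [|n IH] [|k]; rewrite ?bin0 ?expn_gt0//.
by rewrite binS expnS mul2n -addnn leq_add.
Qed.

Lemma conjc_psum (c : nat -> C) n z :
  conjc (psum c n z) = \sum_(k < n) conjc (c k) * conjc z ^+ k.
Proof. by rewrite rmorph_sum; apply: eq_bigr => k _; rewrite rmorphM rmorphXn. Qed.

Context (m : nat) (a b : C).

(** [mu n] is the inner product of the product symbol with z^n; [nu n] will be the coefficient of
    z^n in its Toeplitz image of 1. *)
Let mu n : C := wint m (fun w => cexp (a * w) * conjc (cexp (b * w)) * conjc w ^+ n).
Let nu n : C := m`!%:R / (n + m)`!%:R * mu n.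

(** The kernel is expanded in powers of z under the integral; its partial sums are bounded by
    exp(|w| |z|), which is exponential in w for fixed z. *)
Lemma wint_exp_kernel z :
  wint m (fun w => cexp (a * w) * conjc (cexp (b * w)) * fs_kernel m z w) = pseriesC nu z.
Proof.
have ta : tame (fun w => cexp (a * w)) by apply: poly_approx_tame; exact: poly_approx_cexp.
have tb : tame (fun w => conjc (cexp (b * w))).
  by apply: tame_conjc; apply: poly_approx_tame; exact: poly_approx_cexp.
have tab := tameM ta tb; have [mab [M [A [M0 A0 abM]]]] := tab.
apply/esym/pseriesC_eq.
rewrite (_ : (fun n => _) = (fun n => wint m (fun w =>
    cexp (a * w) * conjc (cexp (b * w)) * psum (kcoef m w) n z))); last first.
  apply/funext => n.
  have tw k : tame (fun w => cexp (a * w) * conjc (cexp (b * w)) * conjc w ^+ k).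
    by apply: tameM => //; exact/tameX/tame_conjc/tame_id.
  have -> : (fun w => cexp (a * w) * conjc (cexp (b * w)) * psum (kcoef m w) n z) =
      (fun w => \sum_(k < n) (m`!%:R / (k + m)`!%:R * z ^+ k) *
         (cexp (a * w) * conjc (cexp (b * w)) * conjc w ^+ k)).
    apply/funext => w; rewrite /psum mulr_sumr; apply: eq_bigr => k _; rewrite /kcoef.
    move: (m`!%:R / _) (cexp (a * w) * _) (_ ^+ k) (z ^+ k) => p q r s.
    by ring.
  rewrite wint_sum => [|k]; last by apply: tameM => //; exact: tame_cst.
  rewrite /psum; apply: eq_bigr => k _; rewrite wintZ//.
  by rewrite /nu mulrAC.
apply: (@wint_cvg _ _ _ _ (M * 1) (A + cabs z)).
- exact: mulr_ge0.
- by rewrite addr_ge0 ?cabs_ge0.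
- move=> n; apply: cmeasM mab _; apply: cmeas_sum => k.
  apply: cmeasM; last exact: cmeas_cst.
  apply: cmeasM; first exact: cmeas_cst.
  by have [] := tameX k (tame_conjc (@tame_id R)).
- move=> n w; rewrite cabsM mulrDl expRD mulrACA ler_pM ?cabs_ge0//.
  by rewrite [cabs z * _]mulrC; exact: psum_le (fact_bounded_kcoef m w).
- move=> w; apply: ccvgMl; rewrite fs_kernelE.
  exact: (psum_cvg z (fact_bounded_kcoef m w)).
Qed.

Let term n k : C := conjc (expc b k) * (expc a (n + k) * ((n + k + m)`!%:R / m`!%:R)).

(** Only the conjugate exponential is expanded. Its k-th term carries conj(w)^(n+k), which picks the
    coefficient of degree n + k of e^{aw} by [wint_pseries_monomial]. *)
Let mu_cvg n : ((fun N => \sum_(k < N) term n k) : nat -> C^o) @ \oo --> (mu n : C^o).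
Proof.
have aa : poly_approx (fun w => cexp (a * w)) by exact: poly_approx_cexp.
have ta := poly_approx_tame aa; have [mab [M [A [M0 A0 abM]]]] := ta.
have tn : tame (fun w : C => conjc w ^+ n) by exact/tameX/tame_conjc/tame_id.
have [mn [N [B [N0 B0 nM]]]] := tn.
have tp k : tame (fun w => conjc (psum (expc b) k w)).
  apply: tame_conjc; apply: tame_sum => i.
  by apply: tameM; [exact: tame_cst|exact/tameX/tame_id].
rewrite (_ : (fun _ => _) = (fun p => wint m (fun w =>
    cexp (a * w) * conjc (psum (expc b) p w) * conjc w ^+ n))); last first.
  apply/funext => p.
  have tw k : tame (fun w => cexp (a * w) * conjc w ^+ (n + k)).
    by apply: tameM => //; exact/tameX/tame_conjc/tame_id.
  have -> : (fun w => cexp (a * w) * conjc (psum (expc b) p w) * conjc w ^+ n) =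
      (fun w => \sum_(k < p) conjc (expc b k) * (cexp (a * w) * conjc w ^+ (n + k))).
    apply/funext => w; rewrite conjc_psum mulr_sumr mulr_suml; apply: eq_bigr => k _.
    by rewrite exprD; move: (cexp _) (conjc (expc b k)) (_ ^+ k) (_ ^+ n) => c d e f; ring.
  rewrite wint_sum => [|k]; last by apply: tameM => //; exact: tame_cst.
  apply: eq_bigr => k _; rewrite wintZ// /term.
  by have := wint_pseries_monomial m (n + k) (fact_bounded_expc a); rewrite pseriesC_expc => ->.
apply: (@wint_cvg _ _ _ _ (M * 1 * N) (A + cabs b + B)).
- by rewrite !mulr_ge0.
- by rewrite !addr_ge0 ?cabs_ge0.
- by move=> k; have [] := tameM (tameM ta (tp k)) tn.
- move=> k w; rewrite (cabsM (cexp (a * w) * _)) (cabsM (cexp (a * w))) !mulrDl !expRD.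
  rewrite (_ : _ * (expR _ * _ * _) = (M * expR (A * cabs w)) * (1 * expR (cabs b * cabs w)) * (N * expR (B * cabs w))); last first.
    by move: (expR _) (expR _) (expR _) => c d e; ring.
  rewrite ler_pM ?mulr_ge0 ?cabs_ge0// ler_pM ?cabs_ge0// cabs_conjc.
  exact: psum_le (fact_bounded_expc b).
- move=> w; apply: ccvgM; last exact: ccvg_cst.
  apply: ccvgMl; apply: ccvg_conjc.
  have := psum_cvg w (fact_bounded_expc b).
  by rewrite pseriesC_expc.
Qed.

(** Writing (n+k+m)! as C(n+k+m, m) m! (n+k)! cancels the (n+k)! of the exponential and frees the
    binomial. *)
Let nu_term n k : m`!%:R / (n + m)`!%:R * term n k =
  (m`!%:R / (n + m)`!%:R * a ^+ n) * ((k`!%:R)^-1 * (a * conjc b) ^+ k * 'C(n + m + k, m)%:R).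
Proof.
rewrite /term /expc conjcM rmorphXn fmorphV rmorph_nat /= exprMn exprD.
have -> : (n + m + k = n + k + m)%N by rewrite addnAC.
rewrite -{1}(@bin_fact (n + k + m) m) ?leq_addl// addnK !natrM.
have f0 : (m`!%:R : C) != 0 by rewrite pnatr_eq0 -lt0n fact_gt0.
have h0 : ((n + k)`!%:R : C) != 0 by rewrite pnatr_eq0 -lt0n fact_gt0.
have g0 : ((n + m)`!%:R : C) != 0 by rewrite pnatr_eq0 -lt0n fact_gt0.
have k0 : (k`!%:R : C) != 0 by rewrite pnatr_eq0 -lt0n fact_gt0.
move: (m`!%:R) f0 ((n + m)`!%:R) g0 ((n + k)`!%:R) h0 (k`!%:R) k0 => f f0 g g0 h h0 q q0.
move: ('C(_, _)%:R) (a ^+ n) (a ^+ k) (_ ^+ k) => c d e p.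
by field; rewrite f0 g0 h0 q0.
Qed.

Let nu_cvg n : ((fun N => (m`!%:R / (n + m)`!%:R * a ^+ n) * binser (a * conjc b) m (n + m) N)
  : nat -> C^o) @ \oo --> (nu n : C^o).
Proof.
have := ccvgMl (m`!%:R / (n + m)`!%:R) (@mu_cvg n).
rewrite (_ : (fun N => _ * \sum_(k < N) _) = (fun N => (m`!%:R / (n + m)`!%:R * a ^+ n) *
  binser (a * conjc b) m (n + m) N))//.
apply/funext => N; rewrite /binser !mulr_sumr; apply: eq_bigr => k _.
exact: nu_term.
Qed.

(** Required by the uniqueness of coefficients. The binomial is at most 2^(n+m+k): 2^m enters the
    constant, 2^n doubles |a|, and 2^k doubles the argument of the exponential in |a| |b|. *)
Let nu_bounded : fact_bounded (2 ^+ m * expR (2 * (cabs a * cabs b))) (2 * cabs a) nu.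
Proof.
split; rewrite ?mulr_ge0 ?exprn_ge0 ?expR_ge0 ?cabs_ge0// => n.
apply: (ccvg_le (@nu_cvg n)) => N.
rewrite !cabsM cabsX cabsV !cabs_nat exprMn.
have hb : cabs (binser (a * conjc b) m (n + m) N) <=
    2 ^+ n * 2 ^+ m * expR (2 * (cabs a * cabs b)).
  have le0 : 0 <= 2 * (cabs a * cabs b) by rewrite !mulr_ge0 ?cabs_ge0.
  apply: (le_trans _ (ler_wpM2l _ (exp_partial_le N le0))); last by rewrite mulr_ge0 ?exprn_ge0.
  rewrite mulr_sumr (le_trans (cabs_sum _ _ _))//; apply: ler_sum => k _.
  rewrite !cabsM cabsX cabsM cabs_conjc cabsV !cabs_nat.
  have hbin : ('C(n + m + k, m)%:R : R) <= 2 ^+ n * 2 ^+ m * 2 ^+ k.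
    by rewrite -!exprD -natrX ler_nat bin_le_exp.
  rewrite (le_trans (ler_wpM2l _ hbin))// ?mulr_ge0 ?invr_ge0 ?exprn_ge0 ?mulr_ge0 ?cabs_ge0//.
  rewrite [(2 * _) ^+ k]exprMn le_eqVlt; apply/orP; left; apply/eqP.
  by move: (k`!%:R^-1) ((cabs a * cabs b) ^+ k) (2 ^+ n) (2 ^+ m) (2 ^+ k) => p q r s t; ring.
have hr := @fact_ratio_le R m n.
have h1 : m`!%:R / (n + m)`!%:R * cabs a ^+ n <= n`!%:R^-1 * cabs a ^+ n.
  by rewrite ler_wpM2r ?exprn_ge0 ?cabs_ge0.
rewrite (le_trans (ler_pM _ _ h1 hb))// ?cabs_ge0//.
  by rewrite mulr_ge0 ?divr_ge0 ?exprn_ge0 ?cabs_ge0.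
rewrite le_eqVlt; apply/orP; left; apply/eqP.
by move: (n`!%:R^-1) (cabs a ^+ n) (2 ^+ n) (2 ^+ m) (expR _) => p q r s t; ring.
Qed.

Lemma exp_symbol_mul0 : (0 < m)%N ->
  (forall z, wint m (fun w => cexp (a * w) * conjc (cexp (b * w)) * fs_kernel m z w) =
    cexp (a * z)) ->
  a * b = 0.
Proof.
move=> m0 H.
have [->|a0] := eqVneq a 0; first by rewrite mul0r.
suff /eqP : a * conjc b = 0.
  by rewrite mulf_eq0 conjc_eq0 -mulf_eq0 => /eqP.
have nuE : forall n, nu n = expc a n.
  apply: (pseriesC_inj nu_bounded (fact_bounded_expc a)) => z.
  by rewrite -wint_exp_kernel H pseriesC_expc.
(* The Taylor coefficient of index n - m gives the identity with upper index n, hence the threshold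
   [m]. *)
apply: (@binser_eq0 _ m m m0) => n mn.
have := @nu_cvg (n - m); rewrite (subnK mn) (nuE (n - m)%N) => h.
have f0 : (m`!%:R : C) != 0 by rewrite pnatr_eq0 -lt0n fact_gt0.
have g0 : (n`!%:R : C) != 0 by rewrite pnatr_eq0 -lt0n fact_gt0.
have p0 : a ^+ (n - m) != 0 by rewrite expf_neq0.
have k0 : ((n - m)`!%:R : C) != 0 by rewrite pnatr_eq0 -lt0n fact_gt0.
have := ccvgMl ((m`!%:R / n`!%:R * a ^+ (n - m))^-1) h.
have -> : (m`!%:R / n`!%:R * a ^+ (n - m))^-1 * expc a (n - m) = 'C(n, m)%:R.
  rewrite /expc -{1}(bin_fact mn) !natrM.
  have c0 : ('C(n, m)%:R : C) != 0 by rewrite pnatr_eq0 -lt0n bin_gt0.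
  move: (m`!%:R) f0 ((n - m)`!%:R) k0 (a ^+ _) p0 ('C(_, _)%:R) c0 => f f0 k k0 p p0 c c0.
  by field; rewrite f0 k0 p0 c0.
rewrite (_ : (fun N => _) = binser (a * conjc b) m n)//.
apply/funext => N; rewrite mulKf//.
by rewrite !mulf_neq0// invr_neq0.
Qed.

End Coefficients.

(** * Necessity of ab = 0, and the counterexample to the characterization *)

Section ExpSymbols.
Context {R : realType}.
Local Notation C := R[i].

Lemma toeplitz_prod_eq_mul0 m (a b : C) : (0 < m)%N ->
  toeplitz_prod_eq m (fun z => cexp (a * z)) (fun z => conjc (cexp (b * z)))
    (fun z => cexp (a * z) * conjc (cexp (b * z))) -> a * b = 0.
Proof.
move=> m0 H; apply: (exp_symbol_mul0 m0) => z.
have one : (fun u : C => fs_kernel m u 0) = fun _ => 1.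
  by apply/funext => u; exact: fs_kernel_at0.
have k1 : kernel_span m (fun _ : C => 1).
  by exists [:: 0], (fun _ => 1) => u; rewrite big_seq1 fs_kernel_at0 mulr1.
have Tpsi : toeplitz m (fun u => conjc (cexp (b * u))) (fun _ => 1) = fun _ => 1.
  apply/funext => u; have := toeplitz_conjc_kernel m 0 u (poly_approx_cexp b).
  by rewrite one fs_kernel_at0 mulr0 cexp0 conjc1 mul1r.
have [_ _ _ /(_ z)] := H _ k1.
rewrite Tpsi (toeplitz_analytic m (poly_approx_cexp a) (poly_approx_cst 1)) mulr1.
move=> ->; rewrite toeplitz_wint; congr (wint m _); apply/funext => w.
by rewrite mulr1.
Qed.

Lemma cabs_cexp_le (z : C) : cabs (cexp z) <= expR (cabs z).
Proof.
have := pseriesC_le z (fact_bounded_expc (1 : C)).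
by rewrite pseriesC_expc cabs1 !mul1r.
Qed.

Lemma exp_type_cexp (a : C) : exp_type (fun z => cexp (a * z)).
Proof.
split; first exact: smooth_entire (smooth_cexp 0 a).
(* The [+ 1] keeps the exponent positive when a = 0. *)
exists (cabs a + 1); first by rewrite ltr_wpDl ?cabs_ge0.
apply: (@le_lt_trans _ _ (1%:E)); last exact: ltry.
apply/ess_supP; apply: aeW => p; rewrite lee_fin.
rewrite (le_trans (ler_wpM2r (expR_ge0 _) (cabs_cexp_le _)))// cabsM -expRD.
rewrite -[leRHS]expR0 ler_expR mulNr mulrDl mul1r opprD addrA subrr add0r.
by rewrite oppr_le0 cabs_ge0.
Qed.

(** e^z and e^{bz} are the Fock kernels at 1 and at conj b, and 1 times the conjugate of conj b is
    b. *)
Lemma span_condition_cexp (b : C) (k : int) : b = (2 * pi * k%:~R)%:C * 'i%C ->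
  span_condition (fun z => cexp (1 * z)) (fun z => cexp (b * z)).
Proof.
move=> bE; exists [:: 1], [:: conjc b]; split => //.
- by exists (fun _ => 1) => z; rewrite big_seq1 [RHS]mul1r /Fock_kernel conjc1.
- by exists (fun _ => 1) => z; rewrite big_seq1 [RHS]mul1r /Fock_kernel conjcK.
- move=> a0 b0; rewrite !inE => /eqP -> /eqP ->; exists k.
  by rewrite conjcK mul1r.
Qed.

Lemma not_semicommuting_characterization m : (0 < m)%N ->
  ~ semicommuting_characterization R m.
Proof.
move=> m0 H; pose b : C := (2 * pi * 1%:~R)%:C * 'i%C.
have [[_ fixed_semi] [_ span_fixed]] := H _ _ (exp_type_cexp 1) (exp_type_cexp b).
have semi : semicommuting m (fun z => cexp (1 * z)) (fun z => cexp (b * z)).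
  by apply/fixed_semi/span_fixed; right; exact: (@span_condition_cexp b 1).
(* The product is [b] itself, whose imaginary part 2 pi is nonzero. *)
have := toeplitz_prod_eq_mul0 m0 semi; rewrite mul1r => /(congr1 (@complex.Im R)) /=.
rewrite !mul0r mulr1 addr0 mulr1 => /eqP.
by rewrite mulf_eq0 pnatr_eq0 /= gt_eqF ?pi_gt0.
Qed.

End ExpSymbols.

Theorem theoremB (R : realType) (m : nat) (m_gt0 : (0 < m)%N) :
  (forall a b : R[i],
     toeplitz_prod_eq m (fun z => cexp (a * z)) (fun z => conjc (cexp (b * z)))
       (fun z => cexp (a * z) * conjc (cexp (b * z)))
     <-> a * b = 0) /\
  ~ semicommuting_characterization R m.
Proof.
split; last exact: not_semicommuting_characterization.
move=> a b; split; first exact: toeplitz_prod_eq_mul0.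
exact: toeplitz_prod_eq_of_mul0.
Qed.
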